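(* Let $a\in\mathbb{C}$ with $|a|<1$ and let $1\le p<\infty$. Then $$\|f-S_n^a(f)\|_p\to0\quad (n\to\infty)\qquad\text{for all } f\in L^p(\mathbb{T})$$ holds if and only if there exists a constant $M_p^a>0$, depending only on $p$ (and on the fixed $a$), such that $$\|S_n^a(f)\|_p\le M_p^a\,\|f\|_p\qquad\text{for all } f\in L^p(\mathbb{T})\text{ and all } n=0,1,2,\dots$$
   Context: $\mathbb{T}=\mathbb{R}/2\pi\mathbb{Z}$; functions on $\mathbb{T}$ are real- or complex-valued and identified with $2\pi$-periodic functions on $\mathbb{R}$; $\|f\|_p=\left(\frac1{2\pi}\int_{\mathbb{T}}|f(x)|^p\,dx\right)^{1/p}$. For $a=|a|e^{it_a}$, $|a|<1$, the nonlinear phase function $\theta_a:\mathbb{R}\to\mathbb{R}$ is the continuous function with $e^{i\theta_a(t)}=\dfrac{e^{it}-a}{1-\overline{a}e^{it}}$ (a fixed choice of continuous branch). It is strictly increasing, satisfies $\theta_a(t+2\pi)=\theta_a(t)+2\pi$, and has derivative the Poisson kernel $\theta_a'(t)=p_a(t)=\dfrac{1-|a|^2}{1-2|a|\cos(t-t_a)+|a|^2}$. For $f\in L^1(\mathbb{T})$, $c_k(f)=\dfrac1{2\pi}\displaystyle\int_{-\pi}^{\pi}f(t)e^{-ik\theta_a(t)}p_a(t)\,dt$ for $k\in\mathbb{Z}$, and $S_n^a(f)(x)=\displaystyle\sum_{k=-n}^{n}c_k(f)e^{ik\theta_a(x)}$. *)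

(* Defs.v *)
From mathcomp Require Import all_boot all_order all_algebra.
From mathcomp Require Import all_classical all_reals all_analysis.
From mathcomp Require Import complex.

Set Implicit Arguments.
Unset Strict Implicit.
Unset Printing Implicit Defensive.

Import Order.TTheory GRing.Theory Num.Theory.
Import numFieldNormedType.Exports ComplexField.Normc.

Local Open Scope classical_set_scope.
Local Open Scope ring_scope.
Local Open Scope complex_scope.

Section Defs.
Context {R : realType}.
Implicit Types (a : R[i]) (p t x ta : R) (theta : R -> R) (f : R -> R[i]).

(* e^{it} *)
Definition expi t : R[i] := cos t +i* sin t.

Definition cintegral (D : set R) f : R[i] :=
  (\int[lebesgue_measure]_(t in D) complex.Re (f t))%R +i*
  (\int[lebesgue_measure]_(t in D) complex.Im (f t))%R.

(* A function on the circle is a 2pi-periodic function on R, integrated over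
   [-pi, pi]; the L^p norm is extended-real valued, so it is meaningful (and
   possibly +oo) for every measurable f. *)
Definition Lp_norm p f : \bar R :=
  ((((2 * pi)^-1)%R%:E *
    \int[lebesgue_measure]_(x in `[(- pi)%R, pi]) (normc (f x) `^ p)%:E)
  `^ p^-1)%E.

Definition in_Lp p f : Prop :=
  [/\ forall x, f (x + 2 * pi) = f x,
      measurable_fun setT (fun x => complex.Re (f x)),
      measurable_fun setT (fun x => complex.Im (f x))
    & (Lp_norm p f < +oo)%E].

Definition nonlinear_phase a theta : Prop :=
  continuous theta /\
  forall t, expi (theta t) = (expi t - a) / (1 - conjc a * expi t).

(* ta is an argument of a: a = |a| e^{i ta} *)
Definition poisson a ta t : R :=
  (1 - normc a ^+ 2) / (1 - 2 * normc a * cos (t - ta) + normc a ^+ 2).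

Definition phase_coef a ta theta (k : int) f : R[i] :=
  ((2 * pi)^-1)%:C *
  cintegral `[- pi, pi]
    (fun t => f t * expi (- (k%:~R * theta t)) * (poisson a ta t)%:C).

(* The symmetric sum over -n <= k <= n, indexed by k = j - n for j <= 2n. *)
Definition phase_sum a ta theta (n : nat) f x : R[i] :=
  \sum_(j < (2 * n).+1)
    phase_coef a ta theta (j%:Z - n%:Z) f * expi ((j%:Z - n%:Z)%:~R * theta x).

End Defs.

(* Main.v *)
Require Import Defs.
From mathcomp Require Import all_boot all_order all_algebra.
From mathcomp Require Import all_classical all_reals all_analysis.
From mathcomp Require Import complex.
From mathcomp Require Import measurable_realfun ring lra zify.

(** Convergence of [S_n f] to [f] for every [f] in [L^p] is equivalent to the
uniform boundedness of the operators [S_n], for the usual two reasons.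

If [S_n f] converges for every [f], the numbers [||S_n f||_p] are bounded for
each [f]. Every single [S_n] is a bounded operator, because its coefficients are
integrals of [f] against bounded functions and the [L^1] norm on the circle is
at most the [L^p] norm ([Lp_norm_phase_sum_le]). Since [L^p] is complete
([riesz_fischer], [in_Lp_complete]), the bounds are uniform in [f] by the uniform
boundedness principle ([uniform_boundedness]).

Conversely, suppose that the [S_n] are uniformly bounded. The modes
[e^{ik theta}] are orthonormal for the measure [poisson dt / 2pi]
([phase_coef_mode]), so [S_n] fixes every linear combination of the modes of
index at most [n] in absolute value. It remains to see that these combinations
are dense in [L^p] ([phase_polynomial_dense]); then [f - S_n f] is small because
[f - P] and [S_n (f - P)] are, for a combination [P] close to [f]
([phase_sum_cvg_of_bounded]).

Both orthonormality and density rest on an explicit branch of the phase,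
[phi t = t + 2 atan (r sin (t - ta) / (1 - r cos (t - ta)))] with [r = |a|]. It
satisfies [e^{i phi} = e^{i theta}] ([expi_phase]), its derivative is the
Poisson kernel ([is_derive_phase]) and it increases by [2 pi] over a period
([phase_pi]). Coefficients and partial sums involve [theta] only through integer
powers of [e^{i theta}], so [phi] may replace [theta] everywhere, and
orthonormality is the fundamental theorem of calculus.

For density, an [L^p] function is first approximated by a bounded continuous
function [g] ([continuous_dense_Lp]), and [g] by its Fejer means, computed
directly in the variable [phi], without any change of variables: the kernel
[K_n] is nonnegative, orthonormality gives its mass, and the identity
[(1 - cos u) * K_n u = 1 - cos (n u)] gives its first moment. As
[1 - cos (phi x - phi t)] vanishes on the period only at [t = x], for [x] in the
open interval, Korovkin's argument yields pointwise convergence there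
([cvg_fejer_mean]) and dominated convergence does the rest
([fejer_mean_approx_Lp]). *)

Set Implicit Arguments.
Unset Strict Implicit.
Unset Printing Implicit Defensive.

Import Order.TTheory GRing.Theory Num.Theory.
Import numFieldNormedType.Exports ComplexField.Normc.

Local Open Scope classical_set_scope.
Local Open Scope ring_scope.
Local Open Scope complex_scope.

(** * The uniform boundedness principle for seminorms *)

(** The gliding-hump argument of Sokal, for a sequence of seminorms [q n] on a
submodule [D] that is complete for the seminorm [N]. Only a seminorm is
assumed, so that no quotient by the functions vanishing almost everywhere is
needed. *)
Section UniformBoundedness.
Context {R : realType} {V : lmodType R}.
Variables (D : V -> Prop) (N : V -> R) (q : nat -> V -> R).
Hypothesis D0 : D 0.
Hypothesis DD : forall x y, D x -> D y -> D (x + y).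
Hypothesis DZ : forall c x, D x -> D (c *: x).
Hypothesis N_ge0 : forall x, D x -> 0 <= N x.
Hypothesis NZ : forall c x, D x -> N (c *: x) = `|c| * N x.
Hypothesis qD : forall n x y, D x -> D y -> q n (x + y) <= q n x + q n y.
Hypothesis qZ : forall n c x, D x -> q n (c *: x) = `|c| * q n x.
Hypothesis q_cont : forall n, exists C, forall x, D x -> q n x <= C * N x.

Let ball1 n := [set q n x | x in [set x | D x /\ N x <= 1]].
Let opnorm n : R := sup (ball1 n).

Let N0 : N 0 = 0.
Proof. by rewrite -(scale0r (0 : V)) NZ// normr0 mul0r. Qed.

Let q0 n : q n 0 = 0.
Proof. by rewrite -(scale0r (0 : V)) qZ// normr0 mul0r. Qed.

Let ball1_sup n : has_sup (ball1 n).
Proof.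
split; first by exists (q n 0), 0 => //=; rewrite N0 ler01.
have [C qC] := q_cont n; exists `|C| => _ [x [Dx Nx] <-].
apply: (le_trans (qC _ Dx)); apply: (le_trans (y := `|C| * N x)).
  by rewrite ler_wpM2r ?N_ge0// ler_norm.
by rewrite -[leRHS]mulr1 ler_wpM2l.
Qed.

Let opnorm_ge0 n : 0 <= opnorm n.
Proof.
rewrite -(q0 n); apply: sup_upper_bound; first exact: ball1_sup.
by exists 0 => //=; rewrite N0 ler01.
Qed.

Let le_opnorm n x : D x -> q n x <= opnorm n * N x.
Proof.
move=> Dx; have := N_ge0 Dx; rewrite le_eqVlt => /orP[/eqP Nx0|Nx].
  have [C /(_ x Dx)] := q_cont n.
  by rewrite -Nx0 !mulr0.
rewrite -ler_pdivrMr// mulrC -[X in X * _]gtr0_norm ?invr_gt0// -qZ//.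
apply: sup_upper_bound; first exact: ball1_sup.
exists ((N x)^-1 *: x) => //; split; first exact: DZ.
by rewrite NZ// gtr0_norm ?invr_gt0// mulVf// gt_eqF.
Qed.

(** The constant [2 / 3] only has to exceed the share [1 / 2] of the operator
norm that the tail of the series absorbs in [uniform_boundedness]. *)
Let opnorm_attained n : 0 < opnorm n ->
  exists x, [/\ D x, N x <= 1 & 2 / 3 * opnorm n < q n x].
Proof.
move=> L0; have e0 : 0 < opnorm n / 3 by rewrite divr_gt0.
have [_ [x [Dx Nx] <-] qx] := sup_adherent e0 (ball1_sup n).
exists x; split => //; move: qx; rewrite -/(opnorm n); lra.
Qed.

(** Moving from [x] by [y] or by [- y], one of the two values of a seminorm is
at least its value at [y], whatever [x] is. *)
Let seminorm_pm n x y : D x -> D y ->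
  q n y <= q n (x + y) \/ q n y <= q n (x - y).
Proof.
move=> Dx Dy; have [|lt1] := leP (q n y) (q n (x + y)); first by left.
have [|lt2] := leP (q n y) (q n (x - y)); first by right.
have Dny : D (- y) by rewrite -scaleN1r; exact: DZ.
have : q n (2 *: y) <= q n (x + y) + q n (x - y).
  have -> : 2 *: y = (x + y) + (-1) *: (x - y).
    by rewrite scaleN1r opprB (addrC x) -addrA subrKC scaler_nat mulr2n.
  apply: (le_trans (qD _ _ _)); [exact: DD|by apply/DZ/DD|].
  by rewrite qZ ?normrN1 ?mul1r//; apply: DD.
rewrite qZ// gtr0_norm//; lra.
Qed.

(** If the operator norms are unbounded, a point with unbounded orbit is built
as a series of steps [+- 6^-k g_k], where [g_k] almost realises the norm of
[q (nu k)], a norm exceeding [12 ^+ k]. The sign of each step is chosen so that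
[q (nu k)] is large after that step, whatever the previous steps were, and the
remaining steps are too short to cancel this. *)
Theorem uniform_boundedness :
  (forall u : nat -> V, (forall k, D (u k) /\ N (u k) <= 6^-1 ^+ k) ->
    exists2 x, D x & forall k, N (x - \sum_(j < k) u j) <= 3 * 6^-1 ^+ k) ->
  (forall x, D x -> exists K, forall n, q n x <= K) ->
  exists M, 0 < M /\ forall x, D x -> forall n, q n x <= M * N x.
Proof.
move=> complete ptw.
have [[K LK]|unb] := pselect (exists K, forall n, opnorm n <= K).
  exists (`|K| + 1); split => [|x Dx n]; first by rewrite ltr_wpDl.
  apply: (le_trans (le_opnorm n Dx)); rewrite ler_wpM2r ?N_ge0//.
  by rewrite (le_trans (LK n))// (le_trans (ler_norm _))// lerDl.
have big k : exists n, 12 ^+ k < opnorm n.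
  apply: contrapT => nk; apply: unb; exists (12 ^+ k) => n.
  by rewrite leNgt; apply/negP => lt; apply: nk; exists n.
have [nu nuP] := choice big.
have L0 k : 0 < opnorm (nu k) by rewrite (lt_trans _ (nuP k))// exprn_gt0.
have [g gP] := choice (fun k => opnorm_attained (L0 k)).
pose y k := 6^-1 ^+ k *: g k.
have r0 k : 0 < 6^-1 ^+ k :> R by rewrite exprn_gt0.
have Dy k : D (y k) by apply: DZ; have [] := gP k.
have Ny k : N (y k) <= 6^-1 ^+ k.
  have [Dg Ng _] := gP k; rewrite NZ// gtr0_norm//.
  by rewrite -[leRHS]mulr1 ler_pM2l.
pose step k x :=
  if q (nu k) (y k) <= q (nu k) (x + y k) then y k else - y k.
pose xs := fix xs k := if k is j.+1 then xs j + step j (xs j) else 0.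
pose u k := step k (xs k).
have Du k : D (u k).
  by rewrite /u /step; case: ifP => // _; rewrite -scaleN1r; exact: DZ.
have xsE k : xs k = \sum_(j < k) u j.
  by elim: k => [|k IH]; rewrite ?big_ord0// big_ord_recr /= -IH.
have Dxs k : D (xs k) by elim: k => //= k IH; exact: DD IH (Du k).
have [|x Dx xP] := complete u.
  move=> k; split => //; rewrite /u /step; case: ifP => // _.
  by rewrite -scaleN1r NZ// normrN1 mul1r.
have [K qK] := ptw _ Dx.
(* After step [k] the seminorm [q (nu k)] is at least [2/3 6^-k L], the tail
   takes back at most [1/2 6^-k L], and [6^-k L] exceeds [2 ^+ k]. *)
have grow k : 2 ^+ k <= 6 * K.
  have Dd : D (x - xs k.+1) by apply: DD => //; rewrite -scaleN1r; exact: DZ.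
  have h1 : q (nu k) (y k) <= q (nu k) (xs k.+1).
    rewrite /= /step; case: ifPn => // nle.
    by have [le|//] := seminorm_pm (nu k) (Dxs k) (Dy k); rewrite le in nle.
  have h2 : q (nu k) (xs k.+1) <= q (nu k) x + q (nu k) (x - xs k.+1).
    have -> : xs k.+1 = x + (-1) *: (x - xs k.+1) by rewrite scaleN1r subKr.
    apply: (le_trans (qD _ _ _)) => //; first exact: DZ.
    by rewrite qZ// normrN1 mul1r scaleN1r subKr.
  have h3 : q (nu k) (x - xs k.+1) <= opnorm (nu k) * (3 * 6^-1 ^+ k.+1).
    apply: (le_trans (le_opnorm _ Dd)); rewrite ler_wpM2l//.
    by rewrite xsE.
  have h4 : 6^-1 ^+ k * (2 / 3 * opnorm (nu k)) <= q (nu k) (y k).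
    have [Dg _ qg] := gP k.
    by rewrite qZ// gtr0_norm// ler_pM2l// ltW.
  have h5 : 2 ^+ k <= 6^-1 ^+ k * opnorm (nu k).
    have -> : 2 = 6^-1 * 12 :> R by lra.
    by rewrite exprMn ler_pM2l// ltW.
  have := qK (nu k); rewrite exprS in h3; set L := opnorm _ in h3 h4 h5.
  have h6 : L * (3 * (6^-1 * 6^-1 ^+ k)) = 6^-1 ^+ k * L / 2 by field.
  have h7 : 6^-1 ^+ k * (2 / 3 * L) = 6^-1 ^+ k * L * (2 / 3) by ring.
  lra.
have := archi_boundP (normr_ge0 (6 * K)); set m := Num.bound _ => lt.
exfalso; have := grow m; rewrite leNgt => /negP; apply.
apply: (le_lt_trans (ler_norm _)); apply: (lt_trans lt).
by rewrite -natrX ltr_nat ltn_expl.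
Qed.

End UniformBoundedness.

(** * Real L^p norms and the Riesz-Fischer theorem *)

(** Differentiability of the power function gives its continuity away from [0];
the limit [0] is treated apart. *)
Lemma cvg_norm_powR (R : realType) (p : R) (u : R^nat) (l : R) : 0 < p ->
  u n @[n --> \oo] --> l -> `|u n| `^ p @[n --> \oo] --> `|l| `^ p.
Proof.
move=> p0 ul; have [l0|l0] := eqVneq l 0; last first.
  have lp : 0 < `|l| by rewrite normr_gt0.
  apply: (@continuous_cvg _ _ _ _ _ _ (fun y : R => y `^ p)).
    apply/differentiable_continuous/derivable1_diffP.
    exact: (@ex_derive _ _ _ _ _ _ _ (is_derive1_powR p lp)).
  exact: cvg_norm.
rewrite l0 normr0 powR0 ?gt_eqF//; apply/cvgr0Pnorm_lt => e e0.
rewrite l0 in ul; have e0' : 0 < e `^ p^-1 by rewrite powR_gt0.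
near=> n; rewrite ger0_norm ?powR_ge0//.
have -> : e = (e `^ p^-1) `^ p by rewrite -powRrM mulVf ?gt_eqF// powRr1// ltW.
apply: gt0_ltr_powR; rewrite ?nnegrE ?powR_ge0//.
by near: n; exact: cvgr0_norm_lt.
Unshelve. all: by end_near. Qed.

Lemma cvg0_exists_le (R : realType) (u : (\bar R)^nat) (e : R) :
  u n @[n --> \oo] --> 0%E -> 0 < e -> exists n, (u n <= e%:E)%E.
Proof.
move=> /fine_cvgP[fin /cvgrPdist_le/[swap] e0 /(_ _ e0) small].
have [n [fn sn]] := filter_ex (filterI fin small); exists n.
rewrite -(fineK fn) lee_fin; move: sn; rewrite /= sub0r normrN.
exact: le_trans (ler_norm _).
Qed.

Section LpReal.
Context d (T : measurableType d) (R : realType).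
Variables (mu : {measure set T -> \bar R}) (p : R).
Hypothesis p1 : 1 <= p.
Implicit Types f g : T -> R.

Local Notation Np f := (Lnorm mu p%:E (EFin \o f)).

Let p0 : 0 < p. Proof. exact: lt_le_trans p1. Qed.

Lemma measurable_norm_powR f : measurable_fun setT f ->
  measurable_fun setT (fun x => (`|f x| `^ p)%:E).
Proof.
move=> mf; apply/measurable_EFinP.
exact/(@measurableT_comp _ _ _ _ _ _ (@powR R ^~ p))/measurableT_comp.
Qed.

Lemma Lnorm_leP f (B : R) : 0 <= B ->
  (Np f <= B%:E)%E <-> (\int[mu]_x (`|f x| `^ p)%:E <= (B `^ p)%:E)%E.
Proof.
move=> B0.
have -> : (\int[mu]_x (`|f x| `^ p)%:E = Np f `^ p)%E.
  by rewrite powR_Lnorm ?gt_eqF//.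
rewrite -poweR_EFin; split => h.
  by apply: (gt0_ler_poweR (ltW p0)); rewrite ?in_itv/= ?leey ?andbT ?Lnorm_ge0 ?lee_fin.
have p0' : 0 <= p^-1 by rewrite invr_ge0 ltW.
have := @gt0_ler_poweR _ _ p0' (Np f `^ p)%E (B%:E `^ p)%E.
rewrite !in_itv/= !leey !poweR_ge0 lee_fin powR_ge0 -poweRrM -powRrM.
by rewrite divff ?gt_eqF// poweRe1 ?Lnorm_ge0// powRr1// => /(_ isT isT h).
Qed.

Lemma le_Lnorm f g : measurable_fun setT f -> measurable_fun setT g ->
  (forall x, `|f x| <= `|g x|) -> (Np f <= Np g)%E.
Proof.
move=> mf mg fg; rewrite unlock.
have p0' : 0 <= p^-1 by rewrite invr_ge0 ltW.
apply: (gt0_ler_poweR p0'); rewrite ?in_itv/= ?leey ?andbT.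
- by apply: integral_ge0 => x _; rewrite lee_fin powR_ge0.
- by apply: integral_ge0 => x _; rewrite lee_fin powR_ge0.
apply: ge0_le_integral => //.
- exact: measurable_norm_powR.
- exact: measurable_norm_powR.
- by move=> x _; rewrite lee_fin ge0_ler_powR ?nnegrE// ltW.
Qed.

Lemma ae_eq_Lnorm f g : measurable_fun setT f -> measurable_fun setT g ->
  {ae mu, forall x, f x = g x} -> Np f = Np g.
Proof.
move=> mf mg fg; rewrite unlock; apply: (congr1 (fun I => I `^ p^-1)%E).
apply: ae_eq_integral => //; try exact: measurable_norm_powR.
by apply: filterS fg => x /= -> _.
Qed.

Lemma Lnorm_sum (u : nat -> T -> R) m n :
  (forall k, measurable_fun setT (u k)) ->
  (Np (fun x => \sum_(m <= j < n) u j x)%R <= \sum_(m <= j < n) Np (u j))%E.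
Proof.
move=> mu_; elim: n => [|n IH].
  rewrite big_geq//; rewrite (_ : (fun _ => _) = cst 0); last first.
    by apply/funext => x; rewrite big_geq.
  by rewrite (_ : _ \o _ = cst 0%E)// Lnorm0// eqe gt_eqF.
have [mn|nm] := leqP m n; last first.
  rewrite big_geq//; rewrite (_ : (fun _ => _) = cst 0); last first.
    by apply/funext => x; rewrite big_geq.
  by rewrite (_ : _ \o _ = cst 0%E)// Lnorm0// eqe gt_eqF.
rewrite big_nat_recr//= (_ : (fun _ => _) =
  (fun x => \sum_(m <= j < n) u j x) \+ u n)%R; last first.
  by apply/funext => x; rewrite big_nat_recr.
apply: (le_trans (minkowski_EFin _ _ _ p1)) => //; last exact: leeD.
exact: measurable_sum.
Qed.

End LpReal.

Section RieszFischer.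
Context d (T : measurableType d) (R : realType) (P : probability T R) (p : R).
Hypothesis p1 : 1 <= p.
Implicit Types f g : T -> R.

Local Notation Np f := (Lnorm P p%:E (EFin \o f)).

Let p0 : 0 < p. Proof. exact: lt_le_trans p1. Qed.

(** On a probability space the [L^1] norm is at most the [L^p] norm: Hoelder's
inequality against the constant [1]. *)
Lemma integral_norm_le_Lnorm f : measurable_fun setT f ->
  (\int[P]_x `|f x|%:E <= Np f)%E.
Proof.
move=> mf; have := p1; rewrite le_eqVlt => /predU1P[<-|p1'].
  by rewrite Lnorm1.
have [q0 pq] : 0 < p / (p - 1) /\ p^-1 + (p / (p - 1))^-1 = 1.
  by split; [rewrite divr_gt0 ?subr_gt0|field; rewrite subr_eq0 !gt_eqF].
have m1 : measurable_fun [set: T] (cst 1 : T -> R) by [].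
have := hoelder P mf m1 p0 q0 pq.
rewrite (_ : EFin \o cst 1 = cst 1%E)// Lnorm_cst1.
rewrite [X in (_ * X)%E](_ : _ = 1%E) ?mule1; last first.
  by rewrite -[RHS](poweR1r (p / (p - 1))^-1); congr (_ `^ _)%E; exact: probability_setT.
by rewrite Lnorm1 /=; under eq_integral do rewrite mulr1.
Qed.

(** The [L^1] norms of the [u k] are summable, so the series of the [u k]
converges absolutely on a set [A] of full measure. Replacing [u k] by [0] off
[A] gives a series [v] that converges everywhere. *)
Section Series.
Variables (u : nat -> T -> R) (b B : nat -> R).
Hypothesis mu_ : forall k, measurable_fun setT (u k).
Hypothesis ub : forall k, (Np (u k) <= (b k)%:E)%E.
Hypothesis bB : forall k m, \sum_(k <= j < m) b j <= B k.

Let S x := (\sum_(0 <= k <oo) `|u k x|%:E)%E.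
Let A := [set x | (S x < +oo)%E].
Let v k x := u k x * \1_A x.
Let f x := limn (series (v ^~ x)).

Let mS : measurable_fun setT S.
Proof.
apply: ge0_emeasurable_sum => // k _; exact/measurable_EFinP/measurableT_comp.
Qed.

Let mA : measurable A.
Proof.
by rewrite -[A]setTI; apply: measurable_lte => //; exact: measurable_cst.
Qed.

Let aeA : {ae P, forall x, A x}.
Proof.
have iS : (\int[P]_x S x < +oo)%E.
  rewrite integral_nneseries//; last first.
    by move=> k; exact/measurable_EFinP/measurableT_comp.
  apply: (@le_lt_trans _ _ (B 0)%:E); last by rewrite ltry.
  apply: lime_le.
    by apply: is_cvg_nneseries => k _ _; apply: integral_ge0.
  apply: nearW => n; apply: (le_trans (y := (\sum_(0 <= j < n) b j)%:E)).
    rewrite -sumEFin; apply: lee_sum => j _.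
    exact: le_trans (integral_norm_le_Lnorm (mu_ j)) (ub j).
  by rewrite lee_fin.
have /integrable_ae : P.-integrable setT S.
  apply/integrableP; split => //.
  rewrite (eq_integral S)// => x _; rewrite gee0_abs//.
  by apply: nneseries_ge0.
move=> /(_ measurableT); apply: filterS => x /(_ I).
by rewrite fin_numElt => /andP[].
Qed.

Let mv k : measurable_fun setT (v k).
Proof.
by apply: measurable_funM => //; exact: measurable_indic.
Qed.

Let vE k x : A x -> v k x = u k x.
Proof. by move=> Ax; rewrite /v indicE mem_set// mulr1. Qed.

Let cvg_v x : series (v ^~ x) @ \oo --> f x.
Proof.
apply: normed_cvg; have [Ax|nAx] := pselect (A x); last first.
  rewrite (_ : [normed series _]%classic = cst 0); first exact: is_cvg_cst.
  apply/funext => n /=; rewrite /series/= big1// => k _.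
  by rewrite /v indicE memNset// mulr0 normr0.
apply: nondecreasing_is_cvgn; first by
  exact: (nondecreasing_series (u_ := fun k => `|v k x|) (P := xpredT) (m := 0)).
exists (fine (S x)) => _ [n _ <-].
have S0 : (0 <= S x)%E by apply: nneseries_ge0 => k _ _; rewrite lee_fin.
rewrite -lee_fin fineK ?ge0_fin_numE// /series/= -sumEFin.
apply: le_trans (nneseries_lim_ge n _) => //.
by apply: lee_sum => k _; rewrite lee_fin vE.
Qed.

Let mf : measurable_fun setT f.
Proof.
apply: (measurable_fun_cvg (h := fun n x => series (v ^~ x) n)).
  by move=> n; apply: measurable_sum => k.
by move=> x _; exact: cvg_v.
Qed.

Let Lnorm_v k : (Np (v k) <= (b k)%:E)%E.
Proof.
apply: le_trans (ub k); apply: le_Lnorm => // x; rewrite /v.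
by rewrite normrM ler_piMr// indicE; case: (x \in A); rewrite ?normr1 ?normr0.
Qed.

Let B_ge0 k : 0 <= B k.
Proof. by have := bB k k; rewrite big_geq. Qed.

(** Fatou's lemma along the partial sums from [k] on, whose norms are bounded by
Minkowski's inequality. *)
Let Lnorm_tail k : (Np (fun x => f x - \sum_(j < k) v j x)%R <= (B k)%:E)%E.
Proof.
apply/Lnorm_leP => //.
pose h m x := (`|\sum_(k <= j < m) v j x| `^ p)%:E.
have mh m : measurable_fun setT (h m).
  by apply: measurable_norm_powR; exact: measurable_sum.
have h0 m x : [set: T] x -> (0 <= h m x)%E by rewrite lee_fin powR_ge0.
have hf x : (h m x)%E @[m --> \oo] --> (`|f x - \sum_(j < k) v j x| `^ p)%:E.
  apply: cvg_EFin; first exact: nearW.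
  apply: cvg_norm_powR => //.
  apply: (@cvg_trans _ ((series (v ^~ x) m - \sum_(j < k) v j x) @[m --> \oo])).
    apply: near_eq_cvg; near=> m.
    have -> : \sum_(j < k) v j x = series (v ^~ x) k by rewrite /series/= big_mkord.
    by rewrite sub_series_geq//; near: m; exists k.
  by apply: cvgB; [exact: cvg_v|exact: cvg_cst].
under eq_integral => x _ do rewrite -(cvg_limn_einf_sup (hf x)).1.
apply: (le_trans (fatou P measurableT mh h0)).
rewrite limn_einf_lim; apply: lime_le; first exact: is_cvg_einfs.
apply: nearW => m; apply: (@le_trans _ _ (\int[P]_x h m x)%E).
  by apply: ereal_inf_lbound; exists m => /=.
apply/(Lnorm_leP _ p1) => //; apply: (le_trans (Lnorm_sum _ p1 _ _ mv)).
apply: (@le_trans _ _ (\sum_(k <= j < m) b j)%:E); last by rewrite lee_fin.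
by rewrite -sumEFin; apply: lee_sum.
Unshelve. all: by end_near. Qed.

(** The last clause makes the sum inherit every invariance shared by all the
terms; it is what keeps the sum of periodic functions periodic. *)
Lemma riesz_fischer : exists g, [/\ measurable_fun setT g,
  forall k, (Np (fun x => g x - \sum_(j < k) u j x)%R <= (B k)%:E)%E &
  forall x y, (forall k, u k x = u k y) -> g x = g y].
Proof.
exists f; split => // [k|x y uxy].
  rewrite (_ : Np _ = Np (fun x => f x - \sum_(j < k) v j x)%R)//.
  apply: ae_eq_Lnorm => //.
  - by apply: measurable_funB => //; exact: measurable_sum.
  - by apply: measurable_funB => //; exact: measurable_sum.
  apply: filterS aeA => x Ax; congr (_ - _).
  by apply: eq_bigr => j _; rewrite vE.
rewrite /f; congr (limn _); apply/funext => n; rewrite /series/=.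
have Sxy : S x = S y by apply: eq_eseriesr => k _; rewrite uxy.
have Axy : (x \in A) = (y \in A).
  by apply/idP/idP => /set_mem Ax; apply/mem_set; move: Ax; rewrite /A/= Sxy.
by apply: eq_bigr => k _; rewrite /v uxy !indicE Axy.
Qed.

End Series.
End RieszFischer.

(** * Complex functions on the circle *)

Section ComplexModulus.
Context {R : realType}.
Implicit Types z : R[i].

Lemma normc_sqrtE z : normc z = Num.sqrt (complex.Re z ^+ 2 + complex.Im z ^+ 2).
Proof. by case: z. Qed.

Lemma normc_ge0 z : 0 <= normc z.
Proof. by rewrite normc_sqrtE sqrtr_ge0. Qed.

Lemma Re_le_normc z : `|complex.Re z| <= normc z.
Proof. by rewrite normc_sqrtE -sqrtr_sqr ler_wsqrtr// lerDl sqr_ge0. Qed.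

Lemma Im_le_normc z : `|complex.Im z| <= normc z.
Proof. by rewrite normc_sqrtE -sqrtr_sqr ler_wsqrtr// lerDr sqr_ge0. Qed.

Lemma normc_le_ReIm z : normc z <= `|complex.Re z| + `|complex.Im z|.
Proof.
rewrite normc_sqrtE -[leRHS]ger0_norm ?addr_ge0// -sqrtr_sqr ler_wsqrtr//.
by rewrite sqrrD !real_normK ?num_real// lerD2r lerDl mulrn_wge0// mulr_ge0.
Qed.

Lemma normc_expi (t : R) : normc (expi t) = 1.
Proof. by rewrite normc_sqrtE /= cos2Dsin2 sqrtr1. Qed.

Lemma normc_real (x : R) : normc x%:C = `|x|.
Proof. by rewrite normc_sqrtE /= expr0n/= addr0 sqrtr_sqr. Qed.

End ComplexModulus.

Section Circle.
Context {R : realType}.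

Lemma ltNpi_pi : - pi < pi :> R.
Proof. by rewrite (lt_trans _ (pi_gt0 R))// oppr_lt0 pi_gt0. Qed.

(** The normalised arc length [dx / 2pi] on one period. *)
Definition circle := uniform_prob ltNpi_pi.

Definition measurable_complex (f : R -> R[i]) :=
  measurable_fun setT (fun x => complex.Re (f x)) /\
  measurable_fun setT (fun x => complex.Im (f x)).

Lemma measurable_normc f : measurable_complex f ->
  measurable_fun setT (fun x => normc (f x)).
Proof.
move=> [mr mi]; under eq_fun do rewrite normc_sqrtE.
apply: (@measurableT_comp _ _ _ _ _ _ (@Num.sqrt R)).
  by apply: continuous_measurable_fun; exact: sqrt_continuous.
by apply: measurable_funD; apply: measurable_funX.
Qed.

Lemma ReD (z w : R[i]) : complex.Re (z + w) = complex.Re z + complex.Re w.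
Proof. by case: z w => [a b] [c e]. Qed.

Lemma ImD (z w : R[i]) : complex.Im (z + w) = complex.Im z + complex.Im w.
Proof. by case: z w => [a b] [c e]. Qed.

Lemma measurable_complexD f g : measurable_complex f -> measurable_complex g ->
  measurable_complex (fun x => f x + g x).
Proof.
move=> [mfr mfi] [mgr mgi]; split.
  by under eq_fun do rewrite ReD; exact: measurable_funD.
by under eq_fun do rewrite ImD; exact: measurable_funD.
Qed.

Lemma ReM (z w : R[i]) : complex.Re (z * w) =
  complex.Re z * complex.Re w - complex.Im z * complex.Im w.
Proof. by case: z w => [a b] [c e]. Qed.

Lemma ImM (z w : R[i]) : complex.Im (z * w) =
  complex.Re z * complex.Im w + complex.Im z * complex.Re w.
Proof. by case: z w => [a b] [c e]. Qed.

Lemma measurable_complexM f g : measurable_complex f -> measurable_complex g ->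
  measurable_complex (fun x => f x * g x).
Proof.
move=> [mfr mfi] [mgr mgi]; split.
  under eq_fun do rewrite ReM.
  by apply: measurable_funB; exact: measurable_funM.
under eq_fun do rewrite ImM.
by apply: measurable_funD; exact: measurable_funM.
Qed.

Lemma measurable_complex_cst c : measurable_complex (fun=> c).
Proof. by split; exact: measurable_cst. Qed.

Lemma measurable_complex_sum n (F : 'I_n -> R -> R[i]) :
  (forall i, measurable_complex (F i)) ->
  measurable_complex (fun x => \sum_(i < n) F i x).
Proof.
elim: n F => [|n IH] F mF.
  under eq_fun do rewrite big_ord0; exact: measurable_complex_cst.
under eq_fun do rewrite big_ord_recr/=.
by apply: measurable_complexD => //; exact: IH.
Qed.

Section Norm.
Variable p : R.
Hypothesis p1 : 1 <= p.

Local Notation Np u := (Lnorm circle p%:E (EFin \o u)).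

Let p0 : 0 < p. Proof. exact: lt_le_trans p1. Qed.

(** The factor [1 / 2pi] is absorbed in the measure, which becomes a
probability; this is what makes the [L^1] norm the smallest one. *)
Lemma Lp_normE f : measurable_complex f ->
  Lp_norm p f = Np (fun x => normc (f x)).
Proof.
move=> mf; rewrite /Lp_norm unlock /Lnorm integral_uniform.
- have -> : pi - - pi = 2 * pi :> R by ring.
  apply: (congr1 (fun I => (((2 * pi)^-1)%:E * I) `^ p^-1)%E).
  by apply: eq_integral => x _ /=; rewrite ger0_norm ?normc_ge0.
- by apply: measurable_norm_powR; exact: measurable_normc.
- by move=> x; exact: poweR_ge0.
Qed.

Lemma Lp_norm_ge0 f : (0 <= Lp_norm p f)%E.
Proof. exact: poweR_ge0. Qed.

Lemma Lp_normD f g : measurable_complex f -> measurable_complex g ->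
  (Lp_norm p (fun x => (f x + g x)%R) <= Lp_norm p f + Lp_norm p g)%E.
Proof.
move=> mf mg; rewrite !Lp_normE//; last exact: measurable_complexD.
apply: le_trans (minkowski_EFin _ _ _ p1); try exact: measurable_normc.
apply: le_Lnorm => //.
- by apply: measurable_normc; exact: measurable_complexD.
- by apply: measurable_funD; exact: measurable_normc.
- move=> x /=; rewrite ger0_norm ?normc_ge0// ger0_norm ?addr_ge0 ?normc_ge0//.
  exact: le_normcD.
Qed.

Lemma Lp_normM c f : measurable_complex f ->
  Lp_norm p (fun x => (c * f x)%R) = ((normc c)%:E * Lp_norm p f)%E.
Proof.
move=> mf; rewrite /Lp_norm.
have -> : (\int[lebesgue_measure]_(x in `[(- pi)%R, pi]) (normc (c * f x)%R `^ p)%:E =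
  (normc c `^ p)%:E *
  \int[lebesgue_measure]_(x in `[(- pi)%R, pi]) (normc (f x) `^ p)%:E)%E.
  rewrite -ge0_integralZl//.
  - by apply: eq_integral => x _; rewrite normcM powRM ?normc_ge0// EFinM.
  - apply: measurable_funTS; apply/measurable_EFinP.
    by apply: (@measurableT_comp _ _ _ _ _ _ (@powR R ^~ p)) => //; exact: measurable_normc.
  - by move=> x _; rewrite lee_fin powR_ge0.
  - by rewrite lee_fin powR_ge0.
have I0 : (0 <= \int[lebesgue_measure]_(x in `[(- pi)%R, pi])
    (normc (f x) `^ p)%:E)%E.
  by apply: integral_ge0 => x _; rewrite lee_fin powR_ge0.
have pi0 : 0 <= (2 * pi)^-1 :> R by rewrite invr_ge0 mulr_ge0// pi_ge0.
rewrite muleCA [LHS]poweRM ?lee_fin ?powR_ge0 ?mule_ge0//.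
by rewrite poweR_EFin -powRrM divff ?gt_eqF// powRr1 ?normc_ge0.
Qed.

Lemma Lp_norm_bounded f B : measurable_complex f ->
  (forall x, normc (f x) <= B) -> (Lp_norm p f <= B%:E)%E.
Proof.
move=> mf fB; have B0 : 0 <= B by rewrite (le_trans (normc_ge0 (f 0))).
rewrite Lp_normE//; apply/Lnorm_leP => //.
apply: (@le_trans _ _ (\int[circle]_x (B `^ p)%:E)%E).
  apply: ge0_le_integral => //.
  - by apply: measurable_norm_powR; exact: measurable_normc.
  - by move=> x _; rewrite lee_fin ge0_ler_powR ?nnegrE ?normc_ge0 ?ger0_norm ?normc_ge0// ltW.
rewrite integral_cst// [X in (_ * X)%E](_ : _ = 1%E) ?mule1//.
exact: probability_setT.
Qed.

Lemma integral_normc_le_Lp_norm f : measurable_complex f ->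
  (\int[lebesgue_measure]_(x in `[(- pi)%R, pi]) (normc (f x))%:E <=
   (2 * pi)%:E * Lp_norm p f)%E.
Proof.
move=> mf; have := integral_norm_le_Lnorm circle p1 (measurable_normc mf).
rewrite -Lp_normE// integral_uniform; last 2 first.
- apply/measurable_EFinP/measurableT_comp => //; exact: measurable_normc.
- by move=> x; rewrite lee_fin.
rewrite opprK -mulr2n -[pi *+ 2]mulr_natl lee_pdivrMl ?mulr_gt0 ?pi_gt0//.
by under eq_integral do rewrite ger0_norm ?normc_ge0//.
Qed.

Lemma Lp_norm_le_ReIm f : measurable_complex f ->
  (Lp_norm p f <= Np (fun x => complex.Re (f x)) + Np (fun x => complex.Im (f x)))%E.
Proof.
move=> mf; have [mr mi] := mf; rewrite Lp_normE//.
rewrite -(Lnorm_abse _ (EFin \o (fun x => complex.Re _))).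
rewrite -(Lnorm_abse _ (EFin \o (fun x => complex.Im _))).
apply: le_trans (minkowski_EFin _ _ _ p1); try exact: measurableT_comp.
apply: le_Lnorm => //.
- exact: measurable_normc.
- by apply: measurable_funD; exact: measurableT_comp.
- move=> x /=; rewrite ger0_norm ?normc_ge0// ger0_norm ?addr_ge0//.
  exact: normc_le_ReIm.
Qed.

Lemma Lnorm_Re_le f : measurable_complex f ->
  (Np (fun x => complex.Re (f x)) <= Lp_norm p f)%E.
Proof.
move=> mf; rewrite Lp_normE//; apply: le_Lnorm => //; first by case: mf.
  exact: measurable_normc.
by move=> x; rewrite [leRHS]ger0_norm ?normc_ge0// Re_le_normc.
Qed.

Lemma Lnorm_Im_le f : measurable_complex f ->
  (Np (fun x => complex.Im (f x)) <= Lp_norm p f)%E.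
Proof.
move=> mf; rewrite Lp_normE//; apply: le_Lnorm => //; first by case: mf.
  exact: measurable_normc.
by move=> x; rewrite [leRHS]ger0_norm ?normc_ge0// Im_le_normc.
Qed.

End Norm.
End Circle.

(** * An explicit branch of the nonlinear phase *)

Section Phase.
Context {R : realType}.

Lemma expiD (x y : R) : expi (x + y) = expi x * expi y.
Proof.
by apply/eqP; rewrite eq_complex /= cosD sinD eqxx/= addrC eqxx.
Qed.

Lemma expiN (x : R) : expi (- x) = conjc (expi x).
Proof. by rewrite /expi/= cosN sinN. Qed.

(** Integer multiples are determined by [e^{ix}] alone: this is why the choice
of a branch of the phase does not matter. *)
Lemma eq_expi_int (x y : R) (k : int) :
  expi x = expi y -> expi (k%:~R * x) = expi (k%:~R * y).
Proof.
move=> xy; have nat_case n : expi (n%:R * x) = expi (n%:R * y).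
  by elim: n => [|n IH]; rewrite ?mul0r// -natr1 !mulrDl !mul1r !expiD IH xy.
case: k => n; first exact: nat_case.
by rewrite NegzE !mulrNz !mulNr !expiN [conjc _](congr1 _ (nat_case n.+1)).
Qed.

Variables (r ta : R).
Hypotheses (r0 : 0 <= r) (r1 : r < 1).

(** With [w] the point [conj a * e^{it}] of the open unit disc, the Moebius
quotient is [e^{it} * conj (1 - w) / (1 - w)]; as [1 - w] has positive real
part, its argument is given by an arctangent, which yields a global smooth
branch. *)
Definition phase t := t + 2 * atan (r * sin (t - ta) / (1 - r * cos (t - ta))).

(** The Poisson kernel as a function of the modulus [r], convertible to
[poisson a ta] when [r] is [normc a]. *)
Definition poisson_kernel t := (1 - r ^+ 2) / (1 - 2 * r * cos (t - ta) + r ^+ 2).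

Lemma one_sub_rcos_gt0 t : 0 < 1 - r * cos t.
Proof.
rewrite subr_gt0 (le_lt_trans _ r1)//; apply: le_trans (ler_norm _) _.
by rewrite normrM (ger0_norm r0) ler_piMr// cos_max.
Qed.

(** The denominator is [|1 - w|^2] with [w = r e^{it}]. *)
Lemma poisson_kernel_denE t : 1 - 2 * r * cos t + r ^+ 2 =
  (1 - r * cos t) ^+ 2 + (r * sin t) ^+ 2.
Proof.
transitivity (1 - 2 * r * cos t + r ^+ 2 * (cos t ^+ 2 + sin t ^+ 2)).
  by rewrite cos2Dsin2 mulr1.
by ring.
Qed.

Lemma poisson_kernel_den_gt0 t : 0 < 1 - 2 * r * cos t + r ^+ 2.
Proof.
by rewrite poisson_kernel_denE ltr_wpDr ?sqr_ge0// exprn_gt0// one_sub_rcos_gt0.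
Qed.

Lemma poisson_kernel_gt0 t : 0 < poisson_kernel t.
Proof.
by rewrite divr_gt0 ?poisson_kernel_den_gt0// subr_gt0 expr_lt1.
Qed.

Lemma poisson_kernel_le t : poisson_kernel t <= (1 - r ^+ 2) / (1 - r) ^+ 2.
Proof.
apply: ler_wpM2l; first by rewrite subr_ge0 expr_le1// ltW.
rewrite lef_pV2 ?posrE ?poisson_kernel_den_gt0 ?exprn_gt0 ?subr_gt0//.
have : r * cos (t - ta) <= r by rewrite ler_piMr// cos_le1.
by nra.
Qed.

Lemma is_derive_phase (t : R) : is_derive t 1 phase (poisson_kernel t).
Proof.
set X : R -> R := fun t => 1 - r * cos (t - ta).
set Y : R -> R := fun t => r * sin (t - ta).
have X0 : X t != 0 by rewrite gt_eqF// one_sub_rcos_gt0.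
have dsub : is_derive t 1 (fun t => t - ta) 1.
  have := is_deriveB (is_derive_id t 1) (is_derive_cst ta t 1).
  by rewrite subr0.
have dcos := @is_derive1_comp _ _ (fun t => t - ta) t _ _ (is_derive_cos (t - ta)) dsub.
have dsin := @is_derive1_comp _ _ (fun t => t - ta) t _ _ (is_derive_sin (t - ta)) dsub.
have dX : is_derive t 1 X (Y t).
  have h := is_deriveB (is_derive_cst (1 : R) t 1) (is_deriveZ r dcos).
  suff <- : 0 - r *: (- sin (t - ta) * 1) = Y t by exact: h.
  by rewrite /Y sub0r mulr1 scalerN opprK.
have dY : is_derive t 1 Y (r * cos (t - ta)).
  have h := is_deriveZ r dsin.
  suff <- : r *: (cos (t - ta) * 1) = r * cos (t - ta) by exact: h.
  by rewrite mulr1.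
have dV := is_deriveV X0 dX.
have dQ := is_deriveM dY dV.
have dA := @is_derive1_comp _ _ (Y * (fun t => (X t)^-1)) t _ _
  (is_derive1_atan (Y t / X t)) dQ.
have h := is_deriveD (is_derive_id t 1) (is_deriveZ 2 dA).
suff -> : poisson_kernel t = 1 + 2 *: ((1 + (Y t / X t) ^+ 2)^-1 *
  (Y t *: (- X t ^- 2 *: Y t) + (X t)^-1 *: (r * cos (t - ta)))) by exact: h.
rewrite /GRing.scale /= /poisson_kernel poisson_kernel_denE -/(X t) -/(Y t).
have C : cos (t - ta) ^+ 2 + sin (t - ta) ^+ 2 = 1 by exact: cos2Dsin2.
have D0 : X t ^+ 2 + Y t ^+ 2 != 0.
  by rewrite gt_eqF// ltr_wpDr ?sqr_ge0// exprn_gt0// one_sub_rcos_gt0.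
have D1 : 1 + (Y t / X t) ^+ 2 != 0.
  by rewrite gt_eqF// ltr_wpDr ?sqr_ge0.
have -> : 1 - r ^+ 2 = X t ^+ 2 + Y t ^+ 2 + 2 * (r * cos (t - ta) * X t - Y t * Y t).
  transitivity (1 - r ^+ 2 * (cos (t - ta) ^+ 2 + sin (t - ta) ^+ 2)).
    by rewrite C mulr1.
  by rewrite /X /Y; ring.
move: X0 D0 D1; move: (X t) (Y t) (cos _) => x y c x0 d0 d1.
by field; rewrite x0 d0.
Qed.

Lemma phase_continuous : continuous phase.
Proof.
move=> t; apply/differentiable_continuous/derivable1_diffP.
exact: (@ex_derive _ _ _ _ _ _ _ (is_derive_phase t)).
Qed.

Lemma poisson_kernel_continuous : continuous poisson_kernel.
Proof.
move=> t; apply: cvgM; first exact: cvg_cst.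
apply: cvgV; first by rewrite gt_eqF// poisson_kernel_den_gt0.
apply: cvgD; last exact: cvg_cst.
apply: cvgB; first exact: cvg_cst.
apply: cvgM; first exact: cvg_cst.
apply: (@continuous_comp _ _ _ (fun t => t - ta) cos); last exact: continuous_cos.
by apply: cvgB; [exact: cvg_id|exact: cvg_cst].
Qed.

Lemma ltr_phase : {homo phase : x y / x < y}.
Proof.
move=> x y xy; rewrite -subr_gt0.
have [|c _ ->] := MVT xy (fun z _ => is_derive_phase z).
  by apply: continuous_subspaceT; exact: phase_continuous.
by rewrite mulr_gt0 ?subr_gt0// poisson_kernel_gt0.
Qed.

(** The arctangent part is periodic, so the phase winds exactly once around the
circle over a period. *)
Lemma phase_pi : phase pi = phase (- pi) + 2 * pi.
Proof.
rewrite /phase; have -> : pi - ta = - pi - ta + pi *+ 2 by rewrite mulr2n; ring.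
by rewrite cosD2pi sinD2pi; ring.
Qed.

Lemma expi_2atan (y : R) :
  expi (2 * atan y) = ((1 - y ^+ 2) / (1 + y ^+ 2)) +i* (2 * y / (1 + y ^+ 2)).
Proof.
have d0 : 0 < 1 + y ^+ 2 by rewrite ltr_wpDr ?sqr_ge0.
have c2 : cos (atan y) ^+ 2 = (1 + y ^+ 2)^-1.
  by rewrite cos_atan exprVn sqr_sqrtr// ltW.
have c0 : cos (atan y) != 0.
  by rewrite cos_atan invr_neq0// gt_eqF// sqrtr_gt0.
have sE : sin (atan y) = y * cos (atan y).
  by rewrite -{2}(atanK y) /tan divfK.
rewrite -[2]/(1 + 1) mulrDl mul1r expiD /expi /GRing.mul /= sE.
set c := cos _ in c2 *.
have -> : c * c - y * c * (y * c) = (1 - y ^+ 2) * c ^+ 2 by ring.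
have -> : c * (y * c) + y * c * c = 2 * y * c ^+ 2 by ring.
by rewrite c2.
Qed.

Lemma expi_phase a t : a = r%:C * expi ta ->
  expi (phase t) = (expi t - a) / (1 - conjc a * expi t).
Proof.
move=> aE; set X : R := 1 - r * cos (t - ta); set Y : R := r * sin (t - ta).
have X0 : X != 0 by rewrite gt_eqF// one_sub_rcos_gt0.
have D0 : X ^+ 2 + Y ^+ 2 != 0.
  by rewrite gt_eqF// ltr_wpDr ?sqr_ge0// exprn_gt0// one_sub_rcos_gt0.
have wE : 1 - conjc a * expi t = X +i* (- Y).
  have -> : conjc a = r%:C * expi (- ta).
    rewrite aE; apply/eqP; rewrite eq_complex /= cosN sinN.
    by rewrite !mul0r addr0 !mulrN !addr0 !eqxx.
  rewrite -mulrA -expiD (addrC (- ta)).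
  by apply/eqP; rewrite eq_complex /= !mul0r subr0 addr0 sub0r !eqxx.
have uE : expi t - a = expi t * (X +i* Y).
  have -> : X +i* Y = 1 - r%:C * expi (- (t - ta)).
    apply/eqP; rewrite eq_complex /= cosN sinN !mul0r subr0 addr0 sub0r.
    by rewrite mulrN opprK !eqxx.
  rewrite mulrBr mulr1 mulrCA -expiD aE; congr (_ - _ * expi _); ring.
have w0 : X +i* (- Y) != 0 by rewrite eq_complex /= negb_and X0.
rewrite wE uE /phase expiD -[RHS]mulrA expi_2atan -/X -/Y; congr (_ * _).
have D1 : 1 + (Y / X) ^+ 2 != 0 by rewrite gt_eqF// ltr_wpDr ?sqr_ge0.
apply: (mulIf w0); rewrite divfK//; apply/eqP; rewrite eq_complex /=.
move: X Y X0 D0 D1 {wE uE w0} => x y x0 d0 d1.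
by apply/andP; split; apply/eqP; field; rewrite x0 d0.
Qed.

End Phase.
(** * Fejer means in the nonlinear phase *)

Section PeriodIntegral.
Context {R : realType}.
Local Notation mu := (@lebesgue_measure R).
Implicit Types f F g : R -> R.

Local Notation period := (`[(- pi)%R, pi]%classic : set R).

Lemma continuous_integrable_period f : continuous f ->
  mu.-integrable period (EFin \o f).
Proof.
move=> cf; apply: continuous_compact_integrable; first exact: segment_compact.
exact: continuous_subspaceT.
Qed.

Lemma Rintegral_derivative F f : (forall t : R, is_derive t 1 F (f t)) ->
  continuous f -> \int[mu]_(t in period) f t = F pi - F (- pi).
Proof.
move=> dF cf; have cF : continuous F.
  move=> t; apply/differentiable_continuous/derivable1_diffP.
  exact: (@ex_derive _ _ _ _ _ _ _ (dF t)).
rewrite /Rintegral (@continuous_FTC2 _ f F) //; first exact: ltNpi_pi.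
- exact: continuous_subspaceT.
- split => [t _||]; first exact: (@ex_derive _ _ _ _ _ _ _ (dF t)).
    by apply: cvg_at_right_filter; exact: cF.
  by apply: cvg_at_left_filter; exact: cF.
- by move=> t _; rewrite derive1E; exact: derive_val.
Qed.

Lemma continuous_sum_ord n (f : 'I_n -> R -> R) :
  (forall i, continuous (f i)) -> continuous (fun t => \sum_(i < n) f i t).
Proof.
move=> cf t; apply: cvg_big => [|i _]; first exact: add_continuous.
exact: cf.
Qed.

Lemma Rintegral_sum_period n (f : 'I_n -> R -> R) :
  (forall i, continuous (f i)) ->
  \int[mu]_(t in period) (\sum_(i < n) f i t) =
  \sum_(i < n) \int[mu]_(t in period) f i t.
Proof.
elim: n f => [|n IH] f cf.
  rewrite big_ord0; under eq_Rintegral do rewrite big_ord0.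
  by rewrite Rintegral_cst// mul0r.
under eq_Rintegral do rewrite big_ord_recr/=.
rewrite RintegralD//; first by rewrite IH// big_ord_recr.
- by apply: continuous_integrable_period; exact: continuous_sum_ord.
- exact: continuous_integrable_period.
Qed.

End PeriodIntegral.

Section Fejer.
Context {R : realType} (r ta : R).
Hypotheses (r0 : 0 <= r) (r1 : r < 1).
Local Notation mu := (@lebesgue_measure R).
Local Notation period := (`[(- pi)%R, pi]%classic : set R).
Local Notation phi := (phase r ta).
Local Notation ker := (poisson_kernel r ta).
Implicit Types (k : int) (m n : nat) (x t u : R) (g : R -> R).

Lemma expi_phase_pi k : expi (k%:~R * phi pi) = expi (k%:~R * phi (- pi)).
Proof.
apply: eq_expi_int; rewrite phase_pi expiD [expi (2 * pi)](_ : _ = 1) ?mulr1//.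
by rewrite mulr_natl /expi cos2pi sin2pi.
Qed.

Let phi_cont : continuous phi. Proof. exact: phase_continuous. Qed.
Let ker_cont : continuous ker. Proof. exact: poisson_kernel_continuous. Qed.

Let cos_cont k : continuous (fun t => cos (k%:~R * phi t)).
Proof.
move=> t; apply: (@continuous_comp _ _ _ (fun t => k%:~R * phi t) cos).
  by apply: cvgM; [exact: cvg_cst|exact: phi_cont].
exact: continuous_cos.
Qed.

Let sin_cont k : continuous (fun t => sin (k%:~R * phi t)).
Proof.
move=> t; apply: (@continuous_comp _ _ _ (fun t => k%:~R * phi t) sin).
  by apply: cvgM; [exact: cvg_cst|exact: phi_cont].
exact: continuous_sin.
Qed.

Let is_derive_mphase k t : is_derive t 1 (fun t => k%:~R * phi t) (k%:~R * ker t).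
Proof. exact: (is_deriveZ k%:~R (is_derive_phase ta r0 r1 t)). Qed.

(** For [k != 0] the integrand is the derivative of [sin (k phi) / k], which
takes equal values at both ends of the period; for [k = 0] it is the derivative
of [phi], which increases by [2 pi]. *)
Lemma integral_cos_phase k :
  \int[mu]_(t in period) (cos (k%:~R * phi t) * ker t) =
  if k == 0 then 2 * pi else 0.
Proof.
have [->|k0] := eqVneq k 0.
  under eq_Rintegral do rewrite mul0r cos0 mul1r.
  rewrite (Rintegral_derivative (is_derive_phase ta r0 r1))//.
  by rewrite phase_pi; ring.
have kR0 : k%:~R != 0 :> R by rewrite intr_eq0.
pose F t := k%:~R^-1 * sin (k%:~R * phi t).
have dF t : is_derive t 1 F (cos (k%:~R * phi t) * ker t).
  have h := is_deriveZ k%:~R^-1 (@is_derive1_comp _ _ (fun t => k%:~R * phi t)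
    t _ _ (is_derive_sin _) (is_derive_mphase k t)).
  suff -> : cos (k%:~R * phi t) * ker t =
    k%:~R^-1 *: (cos (k%:~R * phi t) * (k%:~R * ker t)) by exact: h.
  by rewrite /GRing.scale /=; field.
rewrite (Rintegral_derivative dF).
  by rewrite /F; have [_ ->] := expi_phase_pi k; rewrite subrr.
by move=> t; apply: cvgM; [exact: cos_cont|exact: ker_cont].
Qed.

Lemma integral_sin_phase k :
  \int[mu]_(t in period) (sin (k%:~R * phi t) * ker t) = 0.
Proof.
have [->|k0] := eqVneq k 0.
  under eq_Rintegral do rewrite mul0r sin0 mul0r.
  by rewrite Rintegral_cst// mul0r.
have kR0 : k%:~R != 0 :> R by rewrite intr_eq0.
pose F t := - k%:~R^-1 * cos (k%:~R * phi t).
have dF t : is_derive t 1 F (sin (k%:~R * phi t) * ker t).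
  have h := is_deriveZ (- k%:~R^-1) (@is_derive1_comp _ _ (fun t => k%:~R * phi t)
    t _ _ (is_derive_cos _) (is_derive_mphase k t)).
  suff -> : sin (k%:~R * phi t) * ker t =
    - k%:~R^-1 *: (- sin (k%:~R * phi t) * (k%:~R * ker t)) by exact: h.
  by rewrite /GRing.scale /=; field.
rewrite (Rintegral_derivative dF).
  by rewrite /F; have [-> _] := expi_phase_pi k; rewrite subrr.
by move=> t; apply: cvgM; [exact: sin_cont|exact: ker_cont].
Qed.

Lemma integral_cos_phase_diff k x :
  \int[mu]_(t in period) (cos (k%:~R * (phi x - phi t)) * ker t) =
  if k == 0 then 2 * pi else 0.
Proof.
under eq_Rintegral.
  move=> t _; rewrite mulrBr cosB mulrDl -!mulrA; over.
have ck : continuous (fun t => cos (k%:~R * phi t) * ker t).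
  by move=> t; apply: cvgM; [exact: cos_cont|exact: ker_cont].
have sk : continuous (fun t => sin (k%:~R * phi t) * ker t).
  by move=> t; apply: cvgM; [exact: sin_cont|exact: ker_cont].
rewrite RintegralD//; last 2 first.
- by apply: continuous_integrable_period => t; apply: cvgM; [exact: cvg_cst|exact: ck].
- by apply: continuous_integrable_period => t; apply: cvgM; [exact: cvg_cst|exact: sk].
rewrite !RintegralZl//; try exact: continuous_integrable_period.
rewrite integral_cos_phase integral_sin_phase mulr0 addr0.
by case: eqP => [->|_]; rewrite ?mulr0// mul0r cos0 mul1r.
Qed.

(** Up to the factor [1 / n], the Fejer kernel: the squared modulus of the
geometric sum [sum_(j < n) e^{iju}]. *)
Definition fejer_kernel n u :=
  (\sum_(j < n) cos (j%:R * u)) ^+ 2 + (\sum_(j < n) sin (j%:R * u)) ^+ 2.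

Lemma fejer_kernel_ge0 n u : 0 <= fejer_kernel n u.
Proof. by rewrite addr_ge0 ?sqr_ge0. Qed.

Lemma fejer_kernelE n u : fejer_kernel n u =
  \sum_(j < n) \sum_(l < n) cos ((j%:Z - l%:Z)%:~R * u).
Proof.
rewrite /fejer_kernel !expr2 !big_distrlr/= -big_split/=.
apply: eq_bigr => j _; rewrite -big_split/=; apply: eq_bigr => l _.
by rewrite -cosB -mulrBl rmorphB.
Qed.

(** Multiplying the geometric sum by [1 - e^{iu}] telescopes; [h1] and [h2] below
are the real and imaginary parts of this identity, and the sum of their squares
is twice the claim. *)
Lemma fejer_kernel_telescope n u :
  (1 - cos u) * fejer_kernel n u = 1 - cos (n%:R * u).
Proof.
rewrite /fejer_kernel; set C := \sum_(j < n) _; set S := \sum_(j < n) _.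
have [h1 h2] : (1 - cos u) * C + sin u * S = 1 - cos (n%:R * u) /\
   (1 - cos u) * S - sin u * C = - sin (n%:R * u).
  rewrite /C /S; elim: n {C S} => [|n [IH1 IH2]].
    by rewrite !big_ord0 mul0r cos0 sin0; split; ring.
  have nE : n.+1%:R * u = n%:R * u + u by rewrite -natr1 mulrDl mul1r.
  rewrite !big_ord_recr/= nE cosD sinD.
  set C := \sum_(j < n) _ in IH1 IH2 *; set S := \sum_(j < n) _ in IH1 IH2 *.
  split; lra.
have cu := cos2Dsin2 u; have cnu := cos2Dsin2 (n%:R * u).
suff : 2 * ((1 - cos u) * (C ^+ 2 + S ^+ 2)) = 2 * (1 - cos (n%:R * u)).
  by move=> h; lra.
transitivity (((1 - cos u) * C + sin u * S) ^+ 2 +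
              ((1 - cos u) * S - sin u * C) ^+ 2).
  transitivity ((1 - 2 * cos u + (cos u ^+ 2 + sin u ^+ 2)) * (C ^+ 2 + S ^+ 2)).
    by rewrite cu; ring.
  by ring.
rewrite h1 h2.
transitivity (1 - 2 * cos (n%:R * u) +
   (cos (n%:R * u) ^+ 2 + sin (n%:R * u) ^+ 2)); first by ring.
by rewrite cnu; ring.
Qed.

Lemma fejer_kernel_continuous n : continuous (@fejer_kernel n).
Proof.
have ctrig (f : R -> R) (j : 'I_n) : continuous f ->
    continuous (fun u : R => f (j%:R * u)).
  move=> cf u; apply: (@continuous_comp _ _ _ (fun u => j%:R * u) f); last exact: cf.
  by apply: cvgM; [exact: cvg_cst|exact: cvg_id].
have cc := continuous_sum_ord (fun j => ctrig _ j (@continuous_cos R)).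
have cs := continuous_sum_ord (fun j => ctrig _ j (@continuous_sin R)).
by move=> u; apply: cvgD; rewrite expr2; under eq_fun do rewrite expr2;
  apply: cvgM; [exact: cc|exact: cc|exact: cs|exact: cs].
Qed.

Let fejer_diff_cont n x : continuous (fun t => fejer_kernel n (phi x - phi t)).
Proof.
move=> t; apply: (@continuous_comp _ _ _ (fun t => phi x - phi t)); last first.
  exact: fejer_kernel_continuous.
by apply: cvgB; [exact: cvg_cst|exact: phi_cont].
Qed.

Let cos_diff_cont k x : continuous (fun t => cos (k%:~R * (phi x - phi t)) * ker t).
Proof.
move=> t; apply: cvgM; last exact: ker_cont.
apply: (@continuous_comp _ _ _ (fun t => k%:~R * (phi x - phi t)) cos).
  by apply: cvgM; [exact: cvg_cst|apply: cvgB; [exact: cvg_cst|exact: phi_cont]].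
exact: continuous_cos.
Qed.

(** Only the diagonal terms of the double sum survive integration. *)
Lemma integral_fejer_kernel n x :
  \int[mu]_(t in period) (fejer_kernel n (phi x - phi t) * ker t) =
  2 * pi * n%:R.
Proof.
under eq_Rintegral.
  move=> t _; rewrite fejer_kernelE mulr_suml.
  under eq_bigr do rewrite mulr_suml; over.
rewrite Rintegral_sum_period; last first.
  by move=> j; apply: continuous_sum_ord => l; exact: cos_diff_cont.
rewrite (eq_bigr (fun=> 2 * pi)); last first.
  move=> j _; rewrite Rintegral_sum_period; last by move=> l; exact: cos_diff_cont.
  rewrite (bigD1 j)//= integral_cos_phase_diff subrr eqxx big1 ?addr0// => l lj.
  rewrite integral_cos_phase_diff subr_eq0 eqz_nat; case: eqP => // /ord_inj jl.
  by rewrite jl eqxx in lj.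
by rewrite sumr_const card_ord mulr_natr.
Qed.

(** The first moment stays bounded while the total mass grows like [n]: the
kernel concentrates where [phi t] is close to [phi x]. *)
Lemma integral_fejer_kernel_moment n x : (0 < n)%N ->
  \int[mu]_(t in period)
    ((1 - cos (phi x - phi t)) * fejer_kernel n (phi x - phi t) * ker t) =
  2 * pi.
Proof.
have cn : continuous (fun t => cos (n%:R * (phi x - phi t)) * ker t).
  by rewrite (_ : n%:R = n%:Z%:~R :> R)//; exact: cos_diff_cont.
move=> n0; under eq_Rintegral.
  move=> t _; rewrite fejer_kernel_telescope mulrBl mul1r; over.
rewrite RintegralB//; last 2 first.
- by apply: continuous_integrable_period; exact: ker_cont.
- by apply: continuous_integrable_period; exact: cn.
rewrite [X in _ - X](integral_cos_phase_diff n%:Z x).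
rewrite (Rintegral_derivative (is_derive_phase ta r0 r1))// phase_pi.
case: eqP => [n00|_]; last by ring.
by move: n0; rewrite -(ltr0n R) -[n%:R]/(n%:Z%:~R) n00 ltxx.
Qed.

(** The Cesaro means of the partial sums of a real function, as an integral
against a positive kernel. *)
Definition fejer_mean n g x := (2 * pi * n%:R)^-1 *
  \int[mu]_(t in period) (g t * fejer_kernel n (phi x - phi t) * ker t).

(** Korovkin's estimate: the bound on [h] is integrated term by term against the
kernel, using its mass for [e] and its first moment for [C]. *)
Lemma fejer_average_le n h x e C : (0 < n)%N -> continuous h ->
  (forall t, period t -> `|h t| <= e + C * (1 - cos (phi x - phi t))) ->
  `|fejer_mean n h x| <= e + C / n%:R.
Proof.
move=> n0 ch hC; have nR0 : 0 < n%:R :> R by rewrite ltr0n.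
have pn0 : 0 < 2 * pi * n%:R :> R by rewrite !mulr_gt0// pi_gt0.
have cK : continuous (fun t => fejer_kernel n (phi x - phi t) * ker t).
  by move=> t; apply: cvgM; [exact: fejer_diff_cont|exact: ker_cont].
have cMK : continuous (fun t => (1 - cos (phi x - phi t)) *
    fejer_kernel n (phi x - phi t) * ker t).
  move=> t; apply: cvgM; last exact: ker_cont.
  apply: cvgM; last exact: fejer_diff_cont.
  apply: cvgB; first exact: cvg_cst.
  apply: (@continuous_comp _ _ _ (fun t => phi x - phi t) cos).
    by apply: cvgB; [exact: cvg_cst|exact: phi_cont].
  exact: continuous_cos.
have chK : continuous (fun t => h t * fejer_kernel n (phi x - phi t) * ker t).
  move=> t; apply: cvgM; last exact: ker_cont.
  by apply: cvgM; [exact: ch|exact: fejer_diff_cont].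
rewrite /fejer_mean normrM gtr0_norm ?invr_gt0// ler_pdivrMl//.
apply: le_trans (le_normr_Rintegral _ _) _ => //.
  exact: continuous_integrable_period.
apply: (@le_trans _ _ (\int[mu]_(t in period)
    (e * (fejer_kernel n (phi x - phi t) * ker t) + C *
     ((1 - cos (phi x - phi t)) * fejer_kernel n (phi x - phi t) * ker t)))).
  apply: le_Rintegral => //.
  - apply: continuous_integrable_period => t; apply: cvg_norm; exact: chK.
  - apply: continuous_integrable_period => t.
    apply: cvgD; apply: cvgM; [exact: cvg_cst|exact: cK|exact: cvg_cst|exact: cMK].
  move=> t pt; have K0 := fejer_kernel_ge0 n (phi x - phi t).
  have k0 := ltW (poisson_kernel_gt0 ta r0 r1 t).
  rewrite 2!normrM (ger0_norm K0) (ger0_norm k0).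
  have := hC t pt; rewrite -subr_ge0 => h0.
  rewrite -subr_ge0; have := mulr_ge0 h0 (mulr_ge0 K0 k0).
  by congr (_ <= _); ring.
rewrite RintegralD//; last 2 first.
- by apply: continuous_integrable_period => t; apply: cvgM; [exact: cvg_cst|exact: cK].
- by apply: continuous_integrable_period => t; apply: cvgM; [exact: cvg_cst|exact: cMK].
rewrite !RintegralZl//; try exact: continuous_integrable_period.
rewrite integral_fejer_kernel integral_fejer_kernel_moment//.
by rewrite le_eqVlt; apply/orP; left; apply/eqP; field; rewrite gt_eqF.
Qed.

Lemma fejer_meanB_cst n g c x : (0 < n)%N -> continuous g ->
  fejer_mean n g x - c = fejer_mean n (fun t => g t - c) x.
Proof.
move=> n0 cg; have nR0 : n%:R != 0 :> R by rewrite pnatr_eq0 -lt0n.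
have pi0 : pi != 0 :> R by rewrite gt_eqF// pi_gt0.
have cK : continuous (fun t => fejer_kernel n (phi x - phi t) * ker t).
  by move=> t; apply: cvgM; [exact: fejer_diff_cont|exact: ker_cont].
rewrite /fejer_mean; under [in RHS]eq_Rintegral do rewrite -mulrA mulrBl.
under [in LHS]eq_Rintegral do rewrite -mulrA.
rewrite RintegralB//; last 2 first.
- by apply: continuous_integrable_period => t; apply: cvgM; [exact: cg|exact: cK].
- by apply: continuous_integrable_period => t; apply: cvgM; [exact: cvg_cst|exact: cK].
rewrite RintegralZl//; last exact: continuous_integrable_period.
rewrite integral_fejer_kernel; move: pi0; generalize (pi : R) => P P0.
by field; rewrite nR0 P0.
Qed.

Lemma fejer_mean_bounded n g B x : (0 < n)%N -> continuous g ->
  (forall t, `|g t| <= B) -> `|fejer_mean n g x| <= B.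
Proof.
move=> n0 cg gB; rewrite -[leRHS]addr0 -(mul0r n%:R^-1).
by apply: fejer_average_le => // t _; rewrite mul0r addr0.
Qed.

Lemma cos_le_far (d v : R) : 0 < d -> d <= v -> v <= 2 * pi - d ->
  cos v <= cos d.
Proof.
move=> d0; wlog vpi : v / v <= pi => [hw dv vd|dv vd].
  have [|pv] := leP v pi; first by move/hw; apply.
  have -> : cos v = cos (2 * pi - v).
    by rewrite -cosN -(cosD2pi (- v)) mulr_natl addrC.
  by apply: hw; lra.
have dpi : d <= pi by exact: le_trans vpi.
move: dv; rewrite le_eqVlt => /predU1P[<-//|dv].
by rewrite ltW// ltr_cos// in_itv/= ?vpi ?dpi ltW// (lt_trans d0).
Qed.

(** Near [x] the difference is at most [e] by continuity; far from [x] on the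
circle it is at most [2 * B], while [1 - cos (phi x - phi t)] is bounded below. *)
Lemma korovkin_bound g B x e : 0 < e -> continuous g ->
  (forall t, `|g t| <= B) -> - pi < x < pi ->
  exists2 C, 0 <= C & forall t, period t ->
    `|g t - g x| <= e + C * (1 - cos (phi x - phi t)).
Proof.
move=> e0 cg gB /andP[pix xpi].
have B0 : 0 <= B by rewrite (le_trans _ (gB 0)).
have [del del0 delP] : exists2 del, 0 < del &
    forall t, `|x - t| < del -> `|g t - g x| < e.
  have /cvgrPdist_lt/(_ e e0)/nbhs_ballP[del /= del0 h] := cg x.
  by exists del => // t xt; rewrite distrC; exact: h.
(* [d] is a lower bound for the distance on the circle between [phi x] and
   [phi t] when [`|x - t| >= del]: the first two terms account for the points
   near [x], the last two for those reached through the end of the period. *)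
pose d := Num.min (Num.min (phi (x + del) - phi x) (phi x - phi (x - del)))
                  (Num.min (phi pi - phi x) (phi x - phi (- pi))).
have phiL := ltr_phase ta r0 r1.
have d0 : 0 < d.
  rewrite /d !lt_min !subr_gt0 !phiL//; first by rewrite ltrBlDr ltrDl.
  by rewrite ltrDl.
have [d1 d2 d3 d4] : [/\ d <= phi (x + del) - phi x, d <= phi x - phi (x - del),
    d <= phi pi - phi x & d <= phi x - phi (- pi)].
  by split; rewrite /d !ge_min lexx ?orbT.
have phipi := phase_pi r ta.
have phile (s t : R) : s <= t -> phi s <= phi t.
  by rewrite le_eqVlt => /predU1P[->//|/phiL/ltW].
have cosd1 : 0 < 1 - cos d.
  rewrite subr_gt0 -(cos0 R) ltr_cos ?in_itv/= ?lexx ?pi_ge0//.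
  by rewrite ltW//=; lra.
exists (2 * B / (1 - cos d)).
  by rewrite divr_ge0 ?mulr_ge0// ltW.
move=> t; rewrite /= in_itv/= => /andP[pit tpi].
have cos1 : 0 <= 1 - cos (phi x - phi t) by rewrite subr_ge0 cos_le1.
have C0 : 0 <= 2 * B / (1 - cos d) by rewrite divr_ge0 ?mulr_ge0// ltW.
have [near|far] := ltP `|x - t| del.
  by rewrite (le_trans (ltW (delP _ near)))// lerDl mulr_ge0.
have gg : `|g t - g x| <= 2 * B.
  by rewrite (le_trans (ler_normB _ _))// mulrDl mul1r lerD.
apply: (le_trans gg); rewrite -[leLHS]add0r; apply: lerD; first exact: ltW.
rewrite -mulrA ler_peMr ?mulr_ge0//.
rewrite mulrC ler_pdivlMr// mul1r lerB//.
have [xt|tx] := leP x t.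
  have xt' : x + del <= t.
    by move: far; rewrite distrC ger0_norm ?subr_ge0//; lra.
  rewrite -cosN opprB; apply: cos_le_far => //.
    by have := phile _ _ xt'; lra.
  by have := phile _ _ tpi; lra.
have tx' : t <= x - del.
  by move: far; rewrite gtr0_norm ?subr_gt0//; lra.
apply: cos_le_far => //.
  by have := phile _ _ tx'; lra.
by have := phile _ _ pit; lra.
Qed.

Lemma cvg_fejer_mean g B x : continuous g -> (forall t, `|g t| <= B) ->
  - pi < x < pi -> fejer_mean n.+1 g x @[n --> \oo] --> g x.
Proof.
move=> cg gB xpi; apply/cvgrPdist_le => e e0.
have e20 : 0 < e / 2 by rewrite divr_gt0.
have [C C0 CP] := korovkin_bound e20 cg gB xpi.
have C10 : 0 < e / 2 / (C + 1) by rewrite divr_gt0// ltr_wpDl.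
near=> n; rewrite distrC fejer_meanB_cst//.
apply: le_trans (fejer_average_le (C := C) (e := e / 2) _ _ _) _ => //.
  by move=> t; apply: cvgB; [exact: cg|exact: cvg_cst].
rewrite [leRHS](splitr e) lerD2l.
apply: (@le_trans _ _ ((C + 1) / n.+1%:R)).
  by rewrite ler_wpM2r ?invr_ge0// lerDl.
rewrite mulrC -ler_pdivlMr ?ltr_wpDl// ltW//.
by near: n; exact: (near_infty_natSinv_lt (PosNum C10)).
Unshelve. all: by end_near. Qed.

(** The Fejer means are trigonometric polynomials in [phi]. *)
Lemma fejer_meanE n g x : continuous g -> fejer_mean n g x = (2 * pi * n%:R)^-1 *
  \sum_(j < n) \sum_(l < n) (
     cos ((j%:Z - l%:Z)%:~R * phi x) *
       (\int[mu]_(t in period) (g t * (cos ((j%:Z - l%:Z)%:~R * phi t) * ker t))) +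
     sin ((j%:Z - l%:Z)%:~R * phi x) *
       (\int[mu]_(t in period) (g t * (sin ((j%:Z - l%:Z)%:~R * phi t) * ker t)))).
Proof.
move=> cg; congr (_ * _).
have cgc k : continuous (fun t => g t * (cos (k%:~R * phi t) * ker t)).
  move=> t; apply: cvgM; first exact: cg.
  by apply: cvgM; [exact: cos_cont|exact: ker_cont].
have cgs k : continuous (fun t => g t * (sin (k%:~R * phi t) * ker t)).
  move=> t; apply: cvgM; first exact: cg.
  by apply: cvgM; [exact: sin_cont|exact: ker_cont].
have term k t : g t * cos (k%:~R * (phi x - phi t)) * ker t =
    cos (k%:~R * phi x) * (g t * (cos (k%:~R * phi t) * ker t)) +
    sin (k%:~R * phi x) * (g t * (sin (k%:~R * phi t) * ker t)).
  by rewrite mulrBr cosB; ring.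
have cterm k : continuous (fun t =>
    cos (k%:~R * phi x) * (g t * (cos (k%:~R * phi t) * ker t)) +
    sin (k%:~R * phi x) * (g t * (sin (k%:~R * phi t) * ker t))).
  move=> t; apply: cvgD; apply: cvgM;
    [exact: cvg_cst|exact: cgc|exact: cvg_cst|exact: cgs].
under eq_Rintegral.
  move=> t _; rewrite fejer_kernelE mulr_sumr mulr_suml.
  under eq_bigr => j _.
    rewrite mulr_sumr mulr_suml.
    under eq_bigr do rewrite term.
    over.
  over.
rewrite Rintegral_sum_period; last first.
  by move=> j; apply: continuous_sum_ord => l; exact: cterm.
apply: eq_bigr => j _; rewrite Rintegral_sum_period; last by move=> l; exact: cterm.
apply: eq_bigr => l _; rewrite RintegralD//; last 2 first.
- by apply: continuous_integrable_period => t; apply: cvgM; [exact: cvg_cst|exact: cgc].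
- by apply: continuous_integrable_period => t; apply: cvgM; [exact: cvg_cst|exact: cgs].
by rewrite !RintegralZl//; exact: continuous_integrable_period.
Qed.

Lemma fejer_mean_continuous n g : continuous g -> continuous (fejer_mean n g).
Proof.
move=> cg; rewrite (funext (fun x => fejer_meanE n x cg)).
move=> x; apply: cvgM; first exact: cvg_cst.
apply: continuous_sum_ord => j; apply: continuous_sum_ord => l {}x.
by apply: cvgD; apply: cvgM; [exact: cos_cont|exact: cvg_cst|
  exact: sin_cont|exact: cvg_cst].
Qed.

(** Dominated convergence on the open interval, where convergence holds at every
point; at the end points it may fail, since [g] need not be periodic. *)
Lemma fejer_mean_approx_Lp (p : R) g (B e : R) : 1 <= p -> continuous g ->
  (forall t, `|g t| <= B) -> 0 < e ->
  exists n, (Lnorm circle p%:E (EFin \o (fun x => g x - fejer_mean n g x)%R) <= e%:E)%E.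
Proof.
move=> p1 cg gB e0; have p0 : 0 < p by exact: lt_le_trans p1.
have B0 : 0 <= B by rewrite (le_trans _ (gB 0)).
pose h n x := `|g x - fejer_mean n.+1 g x| `^ p.
have mdiff n : measurable_fun setT (fun x => g x - fejer_mean n.+1 g x).
  apply: measurable_funB; apply: continuous_measurable_fun => //.
  exact: fejer_mean_continuous.
have mh n : measurable_fun setT (EFin \o h n) by exact: measurable_norm_powR.
have hB n x : h n x <= (2 * B) `^ p.
  rewrite /h ge0_ler_powR ?nnegrE ?mulr_ge0 ?(ltW p0)//.
  rewrite (le_trans (ler_normB _ _))// mulrDl mul1r lerD//.
  exact: fejer_mean_bounded.
have mitv : measurable_fun (`](- pi)%R, pi[%classic : set R) (cst 0%E : R -> \bar R).
  exact: measurable_cst.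
have cvgh : (\int[mu]_(x in `](- pi)%R, pi[%classic) (EFin \o h n) x)%E @[n --> \oo]
    --> 0%E.
  have mitvh n : measurable_fun `](- pi)%R, pi[%classic (EFin \o h n).
    exact: measurable_funTS.
  have [|||_ _] := dominated_convergence (mu := mu) (measurable_itv _) mitvh mitv
    (g := cst ((2 * B) `^ p)%:E).
  - apply: aeW => x; rewrite /= in_itv/= => xpi.
    apply: cvg_EFin; first exact: nearW.
    have := @cvg_norm_powR _ p (fun n => g x - fejer_mean n.+1 g x) 0 p0.
    rewrite normr0 powR0 ?gt_eqF//; apply.
    rewrite -(subrr (g x)); apply: cvgB; first exact: cvg_cst.
    exact: cvg_fejer_mean.
  - have icst : mu.-integrable period (EFin \o cst ((2 * B) `^ p)).
      by apply: continuous_integrable_period => x; exact: cvg_cst.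
    apply: integrableS icst => //.
    by move=> x; rewrite /= !in_itv/= => /andP[/ltW -> /ltW ->].
  - by apply: aeW => x n _; rewrite /= lee_fin ger0_norm ?powR_ge0.
  by rewrite integral0.
have ep0 : 0 < 2 * pi * e `^ p by rewrite !mulr_gt0 ?pi_gt0// powR_gt0.
have [n hn] : exists n, (\int[mu]_(x in `](- pi)%R, pi[%classic) (EFin \o h n) x <=
   (2 * pi * e `^ p)%:E)%E.
  exact: cvg0_exists_le.
exists n.+1; apply/Lnorm_leP => //; first exact: ltW.
rewrite integral_uniform//; last exact: (mh n).
rewrite opprK -mulr2n -[pi *+ 2]mulr_natl.
rewrite lee_pdivrMl ?mulr_gt0 ?pi_gt0//.
rewrite -EFinM integral_itv_bndoo; first exact: hn.
by apply: measurable_funTS; exact: (mh n).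
Qed.

End Fejer.
(** * Density of bounded continuous functions *)

Section Density.
Context {R : realType}.
Local Notation mu := (@lebesgue_measure R).
Local Notation period := (`[(- pi)%R, pi]%classic : set R).
Implicit Types (c x y : R) (u g : R -> R).

(** Truncation at height [c], written with absolute values so that continuity
and measurability are immediate. *)
Definition clip c y := (`|y + c| - `|y - c|) / 2.

Lemma clip_le c y : 0 <= c -> `|clip c y| <= c.
Proof.
move=> c0; rewrite /clip ler_norml; case: (ger0P (y + c)) => h1;
  case: (ger0P (y - c)) => h2; apply/andP; split; lra.
Qed.

Lemma clip_id c y : `|y| <= c -> clip c y = y.
Proof.
rewrite ler_norml => /andP[y1 y2]; rewrite /clip ger0_norm; last by lra.
by rewrite ler0_norm; lra.
Qed.

Lemma clip_lipschitz c x y : 0 <= c -> `|clip c x - clip c y| <= `|x - y|.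
Proof.
move=> c0; rewrite /clip; case: (ger0P (x + c)) => h1;
  case: (ger0P (x - c)) => h2; case: (ger0P (y + c)) => h3;
  case: (ger0P (y - c)) => h4; case: (ger0P (x - y)) => h5;
  rewrite ler_norml; apply/andP; split; lra.
Qed.

Lemma sub_clip_le c y : 0 <= c -> `|y - clip c y| <= `|y|.
Proof.
move=> c0; rewrite /clip; case: (ger0P (y + c)) => h1;
  case: (ger0P (y - c)) => h2; case: (ger0P y) => h3;
  rewrite ler_norml; apply/andP; split; lra.
Qed.

Lemma clip_continuous c : continuous (clip c).
Proof.
move=> y; apply: cvgM; last exact: cvg_cst.
by apply: cvgB; apply: cvg_norm; [apply: cvgD|apply: cvgB];
  (exact: cvg_id || exact: cvg_cst).
Qed.

Lemma measurable_clip c u : measurable_fun setT u ->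
  measurable_fun setT (fun x => clip c (u x)).
Proof.
by apply: measurableT_comp; apply: continuous_measurable_fun; exact: clip_continuous.
Qed.

Variable p : R.
Hypothesis p1 : 1 <= p.
Local Notation Np u := (Lnorm circle p%:E (EFin \o u)).

Let p0 : 0 < p. Proof. exact: lt_le_trans p1. Qed.

(** Dominated convergence: the truncations are eventually equal to [u] at each
point. *)
Lemma clip_approx_Lp u e : measurable_fun setT u -> (Np u < +oo)%E -> 0 < e ->
  exists2 c, 0 <= c & (Np (fun x => u x - clip c (u x))%R <= e%:E)%E.
Proof.
move=> mu_ Nu e0.
pose h (n : nat) x := `|u x - clip n%:R (u x)| `^ p.
have mh n : measurable_fun setT (EFin \o h n).
  apply: measurable_norm_powR; apply: measurable_funB => //; exact: measurable_clip.
have m0 : measurable_fun setT (cst 0%E : R -> \bar R) by exact: measurable_cst.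
have iu : circle.-integrable setT (fun x => (`|u x| `^ p)%:E).
  apply/integrableP; split; first exact: measurable_norm_powR.
  under eq_integral do rewrite gee0_abs ?lee_fin ?powR_ge0//.
  have := poweR_lty p Nu; rewrite powR_Lnorm ?gt_eqF//.
have [|||_ _ cvgh] := dominated_convergence (mu := circle) measurableT mh m0
  (g := fun x => (`|u x| `^ p)%:E).
- apply: aeW => x _; apply: cvg_near_cst; near=> n.
  rewrite /= /h clip_id ?subrr ?normr0 ?powR0 ?gt_eqF//.
  by near: n; exact: nbhs_infty_ger.
- exact: iu.
- apply: aeW => x n _; rewrite /= lee_fin ger0_norm ?powR_ge0//.
  by rewrite /h ge0_ler_powR ?nnegrE ?(ltW p0)// sub_clip_le.
rewrite integral0 in cvgh.
have ep0 : 0 < e `^ p by rewrite powR_gt0.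
have [n hn] := cvg0_exists_le cvgh ep0.
exists n%:R; first exact: ler0n.
by apply/Lnorm_leP => //; exact: ltW.
Unshelve. all: by end_near. Qed.

(** For functions bounded by [c], approximation in [L^1] implies approximation in
[L^p], because [y `^ p <= (2 * c) `^ (p - 1) * y] for [0 <= y <= 2 * c]; and
truncating the continuous approximant at [c] brings it closer to [u]. *)
Lemma bounded_approx_Lp u c e : measurable_fun setT u -> 0 <= c ->
  (forall x, `|u x| <= c) -> 0 < e ->
  exists2 g, continuous g &
    (forall x, `|g x| <= c) /\ (Np (fun x => u x - g x)%R <= e%:E)%E.
Proof.
move=> mu_ c0 uc e0.
have fin_period : (mu period < +oo)%E.
  by rewrite lebesgue_measure_itv /= lte_fin ltNpi_pi -EFinB ltry.
have iu : mu.-integrable period (EFin \o u).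
  apply: measurable_bounded_integrable => //; first exact: measurable_funTS.
  by exists c; split; [exact: num_real|move=> M /ltW cM x _ /=; exact: le_trans cM].
have [g_ [cg ig gu]] := approximation_continuous_integrable (measurable_itv _) fin_period iu.
(* The summand [1] keeps the denominator positive even when [c] is [0]. *)
have k0 : 0 < 2 * pi * e `^ p / ((2 * c) `^ (p - 1) + 1).
  by rewrite divr_gt0 ?ltr_wpDl ?powR_ge0// !mulr_gt0 ?pi_gt0// powR_gt0.
have [n gn] : exists n, (\int[mu]_(x in period) `|(u x - g_ n x)%:E| <=
   (2 * pi * e `^ p / ((2 * c) `^ (p - 1) + 1))%:E)%E.
  exact: cvg0_exists_le.
exists (fun x => clip c (g_ n x)).
  move=> x; apply: (@continuous_comp _ _ _ (g_ n) (clip c)); first exact: cg.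
  exact: clip_continuous.
split => [x|]; first exact: clip_le.
have mg : measurable_fun setT (g_ n) by exact: continuous_measurable_fun.
have mcg : measurable_fun setT (fun x => u x - clip c (g_ n x)).
  by apply: measurable_funB => //; exact: measurable_clip.
apply/Lnorm_leP => //; first exact: ltW.
rewrite integral_uniform//; last exact: measurable_norm_powR.
rewrite opprK -mulr2n -[pi *+ 2]mulr_natl.
rewrite lee_pdivrMl ?mulr_gt0 ?pi_gt0//.
apply: (@le_trans _ _ (\int[mu]_(x in period)
    (((2 * c) `^ (p - 1))%:E * `|(u x - g_ n x)%:E|))%E).
  apply: ge0_le_integral => //.
  - by apply: measurable_funTS; exact: measurable_norm_powR.
  - apply: measurable_funTS; apply/measurable_EFinP.
    apply: measurable_funM => //; apply: measurableT_comp => //.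
    exact: measurable_funB.
  move=> x _; rewrite -EFinM lee_fin -mulr_powRB1// mulrC.
  have uE : u x = clip c (u x) by rewrite clip_id.
  apply: ler_pM => //; rewrite ?powR_ge0//.
    rewrite ge0_ler_powR ?nnegrE ?subr_ge0 ?mulr_ge0//.
    by rewrite (le_trans (ler_normB _ _))// mulrDl mul1r lerD// clip_le.
  by rewrite uE -{2}uE clip_lipschitz.
rewrite ge0_integralZl//; last 2 first.
- by apply: measurable_funTS; apply/measurable_EFinP; apply: measurableT_comp => //;
    exact: measurable_funB.
- by rewrite lee_fin powR_ge0.
apply: (le_trans (lee_pmul _ _ (lexx _) gn)); rewrite ?lee_fin ?powR_ge0//.
  by apply: integral_ge0.
rewrite mulrCA ler_piMr ?mulr_ge0 ?pi_ge0 ?powR_ge0//.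
by rewrite ler_pdivrMr ?ltr_wpDl ?powR_ge0// mul1r lerDl.
Qed.

Lemma continuous_dense_Lp u e : measurable_fun setT u -> (Np u < +oo)%E -> 0 < e ->
  exists g B, [/\ continuous g, forall x, `|g x| <= B &
    (Np (fun x => u x - g x)%R <= e%:E)%E].
Proof.
move=> mu_ Nu e0; have e20 : 0 < e / 2 by rewrite divr_gt0.
have [c c0 uc] := clip_approx_Lp mu_ Nu e20.
have [g cg [gc ug]] := bounded_approx_Lp (measurable_clip c mu_) c0
  (fun x => clip_le (u x) c0) e20.
exists g, c; split => //.
rewrite (_ : (fun x => _) = (fun x => u x - clip c (u x)) \+
  (fun x => clip c (u x) - g x)); last by apply/funext => x /=; rewrite subrKA.
have mg : measurable_fun setT g by exact: continuous_measurable_fun.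
apply: le_trans (minkowski_EFin _ _ _ p1) _.
- by apply: measurable_funB => //; exact: measurable_clip.
- by apply: measurable_funB => //; exact: measurable_clip.
by rewrite (splitr e) EFinD leeD.
Qed.

End Density.
(** * Integrals of complex functions over a period *)

Section ComplexIntegral.
Context {R : realType}.
Local Notation mu := (@lebesgue_measure R).
Local Notation period := (`[(- pi)%R, pi]%classic : set R).
Implicit Types (f g w : R -> R[i]) (c : R[i]).

Definition integrable_complex f := measurable_complex f /\
  (\int[mu]_(x in period) (normc (f x))%:E < +oo)%E.

Lemma integrable_Re_Im f : integrable_complex f ->
  mu.-integrable period (fun x => (complex.Re (f x))%:E) /\
  mu.-integrable period (fun x => (complex.Im (f x))%:E).
Proof.
move=> [mf fi]; have [mr mi] := mf.
have mn : measurable_fun period (fun x => (normc (f x))%:E).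
  by apply: measurable_funTS; apply/measurable_EFinP; exact: measurable_normc.
split; apply/integrableP; split.
- by apply: measurable_funTS; exact/measurable_EFinP.
- apply: le_lt_trans fi; apply: ge0_le_integral => //.
  + by apply: measurable_funTS; apply/measurable_EFinP; exact: measurableT_comp.
  + by move=> x _; rewrite lee_fin Re_le_normc.
- by apply: measurable_funTS; exact/measurable_EFinP.
- apply: le_lt_trans fi; apply: ge0_le_integral => //.
  + by apply: measurable_funTS; apply/measurable_EFinP; exact: measurableT_comp.
  + by move=> x _; rewrite lee_fin Im_le_normc.
Qed.

Lemma cintegralD f g : integrable_complex f -> integrable_complex g ->
  cintegral period (fun x => f x + g x) = cintegral period f + cintegral period g.
Proof.
move=> /integrable_Re_Im[fr fi] /integrable_Re_Im[gr gi]; rewrite /cintegral.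
under eq_Rintegral do rewrite ReD.
under [X in _ +i* X]eq_Rintegral do rewrite ImD.
by rewrite !RintegralD.
Qed.

Lemma cintegralZ c f : integrable_complex f ->
  cintegral period (fun x => c * f x) = c * cintegral period f.
Proof.
move=> /integrable_Re_Im[fr fi]; rewrite /cintegral.
have iZ (k : R) (h : R -> R) : mu.-integrable period (EFin \o h) ->
    mu.-integrable period (EFin \o (fun x => k * h x)).
  by move=> ih; refine (integrableZl _ k ih); exact: measurable_itv.
under eq_Rintegral do rewrite ReM.
under [X in _ +i* X]eq_Rintegral do rewrite ImM.
rewrite RintegralB ?RintegralD ?RintegralZl//; try exact: iZ.
by case: c => c1 c2; rewrite /GRing.mul/=.
Qed.

(** The factor [2] comes from estimating the real and imaginary parts
separately; a constant is all that the boundedness of the coefficients needs. *)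
Lemma normc_cintegral_le f (B : R) : measurable_complex f ->
  (\int[mu]_(x in period) (normc (f x))%:E <= B%:E)%E ->
  normc (cintegral period f) <= 2 * B.
Proof.
move=> mf fB; have fi : integrable_complex f.
  by split => //; apply: le_lt_trans fB _; rewrite ltry.
have [ir ii] := integrable_Re_Im fi.
have mn : measurable_fun period (fun x => (normc (f x))%:E).
  by apply: measurable_funTS; apply/measurable_EFinP; exact: measurable_normc.
apply: le_trans (normc_le_ReIm _) _; rewrite mulrDl mul1r.
have [mr mi] := mf.
apply: lerD; rewrite -lee_fin; apply: le_trans fB; rewrite EFin_normr_Rintegral//;
  (apply: le_trans (le_abse_integral _ _ _) _ => //;
   first by case/integrableP: (ir); first by case/integrableP: (ii));
  apply: ge0_le_integral => //.
- by apply: measurable_funTS; apply/measurable_EFinP; exact: measurableT_comp.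
- by move=> x _; rewrite lee_fin Re_le_normc.
- by apply: measurable_funTS; apply/measurable_EFinP; exact: measurableT_comp.
- by move=> x _; rewrite lee_fin Im_le_normc.
Qed.

Lemma integral_normcM_le f w (P : R) : measurable_complex f -> measurable_complex w ->
  (forall x, normc (w x) <= P) ->
  (\int[mu]_(x in period) (normc (f x * w x))%:E <=
   P%:E * \int[mu]_(x in period) (normc (f x))%:E)%E.
Proof.
move=> mf mw wP; have P0 : 0 <= P by rewrite (le_trans _ (wP 0))// normc_ge0.
rewrite -ge0_integralZl//; last 2 first.
- by apply: measurable_funTS; apply/measurable_EFinP; exact: measurable_normc.
- by move=> x _; rewrite lee_fin normc_ge0.
apply: ge0_le_integral => //.
- by move=> x _; rewrite lee_fin normc_ge0.
- apply: measurable_funTS; apply/measurable_EFinP; apply: measurable_normc.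
  exact: measurable_complexM.
- apply: measurable_funTS; apply/measurable_EFinP; apply: measurable_funM => //.
  exact: measurable_normc.
- move=> x _; rewrite -EFinM lee_fin normcM mulrC.
  by rewrite ler_wpM2r// normc_ge0.
Qed.

End ComplexIntegral.

(** * The partial sums as bounded operators *)

Section PhaseSum.
Context {R : realType} (a : R[i]) (ta : R) (theta : R -> R) (p : R).
Hypotheses (ha : normc a < 1) (hta : a = (normc a)%:C * expi ta).
Hypotheses (htheta : nonlinear_phase a theta) (hp : 1 <= p).
Local Notation mu := (@lebesgue_measure R).
Local Notation period := (`[(- pi)%R, pi]%classic : set R).
Local Notation phi := (phase (normc a) ta).
Local Notation S := (phase_sum a ta theta).
Implicit Types (f g : R -> R[i]) (k : int) (c : R[i]).

Let r0 : 0 <= normc a. Proof. exact: normc_ge0. Qed.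

(** The partial sums only see [theta] through [e^{i theta}], so the explicit
branch may replace it. *)
Lemma expi_int_theta k x : expi (k%:~R * theta x) = expi (k%:~R * phi x).
Proof.
by apply: eq_expi_int; rewrite (expi_phase r0 ha x hta); case: htheta => _ ->.
Qed.

Definition mode k x : R[i] := expi (k%:~R * theta x).

Lemma normc_mode k x : normc (mode k x) = 1.
Proof. exact: normc_expi. Qed.

Lemma modeE k x : mode k x = cos (k%:~R * phi x) +i* sin (k%:~R * phi x).
Proof. exact: expi_int_theta. Qed.

Lemma measurable_mode k : measurable_complex (mode k).
Proof.
have cphi0 : continuous phi by exact: phase_continuous.
have cphi : continuous (fun x => k%:~R * phi x).
  by move=> x; apply: cvgM; [exact: cvg_cst|exact: cphi0].
split; under eq_fun do rewrite modeE /=; apply: continuous_measurable_fun => x.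
- by apply: (@continuous_comp _ _ _ (fun x => k%:~R * phi x) cos);
    [exact: cphi|exact: continuous_cos].
- by apply: (@continuous_comp _ _ _ (fun x => k%:~R * phi x) sin);
    [exact: cphi|exact: continuous_sin].
Qed.

Lemma mode_periodic k x : mode k (x + 2 * pi) = mode k x.
Proof.
apply: eq_expi_int; case: htheta => _ h; rewrite !h.
rewrite expiD [expi (2 * pi)](_ : _ = 1) ?mulr1//.
by rewrite mulr_natl /expi cos2pi sin2pi.
Qed.

Let weight k t : R[i] := mode (- k) t * (poisson a ta t)%:C.

Let P : R := (1 - normc a ^+ 2) / (1 - normc a) ^+ 2.

Let measurable_weight k : measurable_complex (weight k).
Proof.
apply: measurable_complexM; first exact: measurable_mode.
split; last exact: measurable_cst.
by apply: continuous_measurable_fun; exact: (@poisson_kernel_continuous _ _ ta r0 ha).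
Qed.

Let weight_le k t : normc (weight k t) <= P.
Proof.
rewrite normcM normc_mode mul1r normc_real gtr0_norm.
  exact: (poisson_kernel_le ta r0 ha).
exact: (poisson_kernel_gt0 ta r0 ha).
Qed.

Let P0 : 0 <= P.
Proof. exact: le_trans (normc_ge0 _) (weight_le 0 0). Qed.

Lemma phase_coefE k f : phase_coef a ta theta k f =
  ((2 * pi)^-1)%:C * cintegral period (fun t => f t * weight k t).
Proof.
rewrite /phase_coef; congr (_ * cintegral _ _); apply/funext => t.
by rewrite -mulrA /weight /mode mulrNz mulNr.
Qed.

Lemma in_Lp_measurable f : in_Lp p f -> measurable_complex f.
Proof. by case. Qed.

Let integrable_weight k f : in_Lp p f ->
  integrable_complex (fun t => f t * weight k t).
Proof.
move=> fp; have mf := in_Lp_measurable fp; split.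
  exact: measurable_complexM.
apply: le_lt_trans (integral_normcM_le mf (measurable_weight k) (weight_le k)) _.
apply: (@le_lt_trans _ _ (P%:E * ((2 * pi)%:E * Lp_norm p f))%E).
  by rewrite lee_wpmul2l ?lee_fin// integral_normc_le_Lp_norm.
have [_ _ _ fin] := fp.
rewrite muleA -EFinM; apply: lte_mul_pinfty => //.
rewrite lee_fin; apply: mulr_ge0; first exact: P0.
by rewrite mulr_ge0 ?pi_ge0.
Qed.

Lemma phase_coefD k f g : in_Lp p f -> in_Lp p g ->
  phase_coef a ta theta k (fun x => f x + g x) =
  phase_coef a ta theta k f + phase_coef a ta theta k g.
Proof.
move=> fp gp; rewrite !phase_coefE -mulrDr -cintegralD; try exact: integrable_weight.
by congr (_ * cintegral _ _); apply/funext => t; rewrite mulrDl.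
Qed.

Lemma phase_coefZ k c f : in_Lp p f ->
  phase_coef a ta theta k (fun x => c * f x) = c * phase_coef a ta theta k f.
Proof.
move=> fp; rewrite !phase_coefE mulrCA; congr (_ * _).
rewrite -cintegralZ; last exact: integrable_weight.
by congr cintegral; apply/funext => t; rewrite -mulrA.
Qed.

Lemma normc_phase_coef_le k f : in_Lp p f ->
  normc (phase_coef a ta theta k f) <= 2 * P * fine (Lp_norm p f).
Proof.
move=> fp; have mf := in_Lp_measurable fp; have [_ _ _ fin] := fp.
have ffin : Lp_norm p f \is a fin_num.
  by rewrite ge0_fin_numE// Lp_norm_ge0.
have pi0 : 0 < 2 * pi :> R by rewrite mulr_gt0// pi_gt0.
rewrite phase_coefE normcM normc_real gtr0_norm ?invr_gt0//.
set N := fine _.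
rewrite ler_pdivrMl// -[2 * P * N]mulrA [leRHS]mulrCA [_ * (P * N)]mulrCA.
apply: normc_cintegral_le; first exact: measurable_complexM.
apply: le_trans (integral_normcM_le mf (measurable_weight k) (weight_le k)) _.
rewrite [(P * _)%:E]EFinM; apply: lee_wpmul2l; first by rewrite lee_fin.
rewrite [(_ * N)%:E]EFinM fineK//; exact: integral_normc_le_Lp_norm.
Qed.

(** Orthonormality of the modes for the measure [poisson dt / 2pi]. *)
Lemma phase_coef_mode k m : phase_coef a ta theta k (mode m) = (k == m)%:R.
Proof.
rewrite phase_coefE.
have -> : cintegral period (fun t => mode m t * weight k t) =
  (if m - k == 0 then 2 * pi else 0) +i* 0.
  rewrite -(integral_cos_phase ta r0 ha) -(integral_sin_phase ta r0 ha (m - k)).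
  have e t : mode m t * weight k t = (cos ((m - k)%:~R * phi t) * poisson_kernel (normc a) ta t)
     +i* (sin ((m - k)%:~R * phi t) * poisson_kernel (normc a) ta t).
    rewrite mulrA /mode -expiD -mulrDl -rmorphD expi_int_theta.
    by apply/eqP; rewrite eq_complex /= !mulr0 subr0 add0r !eqxx.
  by congr (_ +i* _); apply: eq_Rintegral => t _; rewrite e.
rewrite subr_eq0 eq_sym; case: eqP => _; last by rewrite mulr0.
by rewrite complexr0 -rmorphM mulVf// gt_eqF// mulr_gt0// pi_gt0.
Qed.

Lemma in_LpD f g : in_Lp p f -> in_Lp p g -> in_Lp p (fun x => f x + g x).
Proof.
move=> fp gp; have mf := in_Lp_measurable fp; have mg := in_Lp_measurable gp.
have [pf _ _ nf] := fp; have [pg _ _ ng] := gp.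
have [m1 m2] := measurable_complexD mf mg.
split; [by move=> x; rewrite pf pg|exact: m1|exact: m2|].
exact: le_lt_trans (Lp_normD hp mf mg) (lte_add_pinfty nf ng).
Qed.

Lemma in_LpZ c f : in_Lp p f -> in_Lp p (fun x => c * f x).
Proof.
move=> fp; have mf := in_Lp_measurable fp; have [pf _ _ nf] := fp.
have [m1 m2] := measurable_complexM (measurable_complex_cst c) mf.
split; [by move=> x; rewrite pf|exact: m1|exact: m2|].
rewrite Lp_normM//; apply: lte_mul_pinfty; last exact: nf.
  by rewrite lee_fin normc_ge0.
by [].
Qed.

Lemma in_LpB f g : in_Lp p f -> in_Lp p g -> in_Lp p (fun x => f x - g x).
Proof.
move=> fp gp; have := in_LpD fp (in_LpZ (-1) gp).
by congr in_Lp; apply/funext => x; rewrite mulN1r.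
Qed.

Lemma in_Lp_bounded f B : (forall x, f (x + 2 * pi) = f x) ->
  measurable_complex f -> (forall x, normc (f x) <= B) -> in_Lp p f.
Proof.
move=> pf mf fB; have [m1 m2] := mf; split; [exact: pf|exact: m1|exact: m2|].
exact: le_lt_trans (Lp_norm_bounded hp mf fB) (ltry _).
Qed.

Lemma in_Lp_mode k : in_Lp p (mode k).
Proof.
apply: (@in_Lp_bounded _ 1); [exact: mode_periodic|exact: measurable_mode|].
by move=> x; rewrite normc_mode.
Qed.

Lemma phase_sumE n f x :
  S n f x = \sum_(j < (2 * n).+1) phase_coef a ta theta (j%:Z - n%:Z) f *
                                  mode (j%:Z - n%:Z) x.
Proof. by []. Qed.

Lemma phase_sumD n f g x : in_Lp p f -> in_Lp p g ->
  S n (fun x => f x + g x) x = S n f x + S n g x.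
Proof.
move=> fp gp; rewrite !phase_sumE -big_split/=; apply: eq_bigr => j _.
by rewrite phase_coefD// mulrDl.
Qed.

Lemma phase_sumZ n c f x : in_Lp p f ->
  S n (fun x => c * f x) x = c * S n f x.
Proof.
move=> fp; rewrite !phase_sumE mulr_sumr; apply: eq_bigr => j _.
by rewrite phase_coefZ// mulrA.
Qed.

Lemma normc_sum n (F : 'I_n -> R[i]) :
  normc (\sum_(i < n) F i) <= \sum_(i < n) normc (F i).
Proof.
elim: n F => [|n IH] F; first by rewrite !big_ord0 normc0.
by rewrite !big_ord_recr/= (le_trans (le_normcD _ _))// lerD2r.
Qed.

(** Each partial sum is a bounded operator from [L^p] to the bounded functions,
with a bound that depends on [n]. *)
Lemma normc_phase_sum_le n f x : in_Lp p f ->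
  normc (S n f x) <= (2 * n).+1%:R * (2 * P) * fine (Lp_norm p f).
Proof.
move=> fp; rewrite phase_sumE (le_trans (normc_sum _))//.
apply: (@le_trans _ _ (\sum_(j < (2 * n).+1) 2 * P * fine (Lp_norm p f))).
  apply: ler_sum => j _; rewrite normcM normc_mode mulr1.
  exact: normc_phase_coef_le.
by rewrite sumr_const card_ord -[leRHS]mulrA [leRHS]mulr_natl.
Qed.

Lemma measurable_phase_sum n f : measurable_complex (S n f).
Proof.
apply: measurable_complex_sum => j; apply: measurable_complexM.
  exact: measurable_complex_cst.
exact: measurable_mode.
Qed.

Lemma phase_sum_in_Lp n f : in_Lp p f -> in_Lp p (S n f).
Proof.
move=> fp; apply: in_Lp_bounded; last by move=> x; exact: normc_phase_sum_le.
- by move=> x; rewrite !phase_sumE; apply: eq_bigr => j _; rewrite mode_periodic.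
- exact: measurable_phase_sum.
Qed.

Lemma Lp_norm_phase_sum_le n f : in_Lp p f ->
  (Lp_norm p (S n f) <= ((2 * n).+1%:R * (2 * P) * fine (Lp_norm p f))%:E)%E.
Proof.
move=> fp; apply: Lp_norm_bounded => //; first exact: measurable_phase_sum.
by move=> x; exact: normc_phase_sum_le.
Qed.

Lemma phase_sum_mode n k x : (`|k| <= n)%N -> S n (mode k) x = mode k x.
Proof.
move=> kn; rewrite phase_sumE.
have jn : (absz (k + n%:Z)%R < (2 * n).+1)%N by lia.
rewrite (bigD1 (Ordinal jn))//= big1 ?addr0 => [|j jk].
  rewrite phase_coef_mode (_ : _ - _ = k) ?eqxx ?mul1r//.
  by lia.
rewrite phase_coef_mode; case: eqP => [jE|_]; last by rewrite mul0r.
by case/eqP: jk; apply/ord_inj => /=; lia.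
Qed.

End PhaseSum.

(** * Density of the polynomials in the modes *)

Section Convergence.
Context {R : realType} (a : R[i]) (ta : R) (theta : R -> R) (p : R).
Hypotheses (ha : normc a < 1) (hta : a = (normc a)%:C * expi ta).
Hypotheses (htheta : nonlinear_phase a theta) (hp : 1 <= p).
Local Notation mu := (@lebesgue_measure R).
Local Notation phi := (phase (normc a) ta).
Local Notation S := (phase_sum a ta theta).
Local Notation mode := (mode theta).
Implicit Types (f g : R -> R[i]) (k : int) (c : R[i]).

Let r0 : 0 <= normc a. Proof. exact: normc_ge0. Qed.

(** The span of the modes, described by the only property that the convergence
proof uses: large partial sums reproduce the function. *)
Definition phase_polynomial f := in_Lp p f /\
  exists N, forall n, (N <= n)%N -> forall x, S n f x = f x.

Lemma phase_polynomial_mode k : phase_polynomial (mode k).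
Proof.
split; first exact: (in_Lp_mode ha hta htheta hp k).
by exists `|k|%N => n kn x; exact: (phase_sum_mode ha hta htheta).
Qed.

Lemma phase_polynomialD f g : phase_polynomial f -> phase_polynomial g ->
  phase_polynomial (fun x => f x + g x).
Proof.
move=> [fp [M fM]] [gp [N gN]]; split; first exact: in_LpD.
exists (maxn M N) => n; rewrite geq_max => /andP[Mn Nn] x.
by rewrite (phase_sumD ha hta htheta hp)// fM// gN.
Qed.

Lemma phase_polynomialZ c f : phase_polynomial f ->
  phase_polynomial (fun x => c * f x).
Proof.
move=> [fp [M fM]]; split; first exact: in_LpZ.
by exists M => n Mn x; rewrite (phase_sumZ ha hta htheta hp)// fM.
Qed.

Lemma phase_polynomial0 : phase_polynomial (fun=> 0).
Proof.
have := phase_polynomialZ 0 (phase_polynomial_mode 0).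
by congr phase_polynomial; apply/funext => x; rewrite mul0r.
Qed.

Lemma phase_polynomial_sum n (F : 'I_n -> R -> R[i]) :
  (forall i, phase_polynomial (F i)) ->
  phase_polynomial (fun x => \sum_(i < n) F i x).
Proof.
elim: n F => [|n IH] F pF.
  by under eq_fun do rewrite big_ord0; exact: phase_polynomial0.
under eq_fun do rewrite big_ord_recr/=.
by apply: phase_polynomialD => //; exact: IH.
Qed.

Lemma phase_polynomial_cos k : phase_polynomial (fun x => (cos (k%:~R * phi x))%:C).
Proof.
have := phase_polynomialZ (2^-1)%:C
  (phase_polynomialD (phase_polynomial_mode k) (phase_polynomial_mode (- k))).
congr phase_polynomial; apply/funext => x.
rewrite !(modeE ha hta htheta) mulrNz mulNr cosN sinN.
apply/eqP; rewrite eq_complex /= subrr !mul0r !mulr0 subr0 addr0 eqxx andbT.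
by apply/eqP; lra.
Qed.

Lemma phase_polynomial_sin k : phase_polynomial (fun x => (sin (k%:~R * phi x))%:C).
Proof.
have := phase_polynomialZ (0 +i* (- 2^-1)) (phase_polynomialD
  (phase_polynomial_mode k) (phase_polynomialZ (-1) (phase_polynomial_mode (- k)))).
congr phase_polynomial; apply/funext => x.
rewrite !(modeE ha hta htheta).
have -> : (- k)%:~R * phi x = - (k%:~R * phi x) :> R by rewrite mulrNz mulNr.
rewrite cosN sinN mulN1r.
apply/eqP; rewrite eq_complex /= opprK.
by apply/andP; split; apply/eqP; lra.
Qed.

Lemma phase_polynomial_fejer n (g : R -> R) : continuous g ->
  phase_polynomial (fun x => (fejer_mean (normc a) ta n g x)%:C).
Proof.
move=> cg; under eq_fun do rewrite (fejer_meanE ta r0 ha)// rmorphM rmorph_sum/=.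
apply: phase_polynomialZ; apply: phase_polynomial_sum => j.
under eq_fun do rewrite rmorph_sum/=.
apply: phase_polynomial_sum => l.
under eq_fun do rewrite rmorphD !rmorphM/= ![_ * (Rintegral _ _ _)%:C]mulrC.
apply: phase_polynomialD; apply: phase_polynomialZ.
  exact: phase_polynomial_cos.
exact: phase_polynomial_sin.
Qed.

(** Real and imaginary parts are approximated by bounded continuous functions,
and these by their Fejer means. *)
Lemma phase_polynomial_dense f (e : R) : in_Lp p f -> 0 < e ->
  exists2 P, phase_polynomial P & (Lp_norm p (fun x => f x - P x)%R <= e%:E)%E.
Proof.
move=> fp e0; have mf := in_Lp_measurable fp; have [pf mr mi nf] := fp.
have e40 : 0 < e / 4 by rewrite divr_gt0.
have real_case (u : R -> R) : measurable_fun setT u ->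
    (Lnorm circle p%:E (EFin \o u) <= Lp_norm p f)%E ->
    exists2 v, phase_polynomial (fun x => (v x)%:C) & measurable_fun setT v /\
      (Lnorm circle p%:E (EFin \o (fun x => u x - v x)%R) <= (e / 2)%:E)%E.
  move=> mu_ uf; have [|g [B [cg gB ug]]] := continuous_dense_Lp hp mu_ _ e40.
    exact: le_lt_trans nf.
  have [n gn] := fejer_mean_approx_Lp ta r0 ha hp cg gB e40.
  exists (fejer_mean (normc a) ta n g); first exact: phase_polynomial_fejer.
  have mg : measurable_fun setT g by exact: continuous_measurable_fun.
  have mv : measurable_fun setT (fejer_mean (normc a) ta n g).
    by apply: continuous_measurable_fun; exact: fejer_mean_continuous.
  split=> //; rewrite (_ : (fun x => _) = (fun x => u x - g x) \+
    (fun x => g x - fejer_mean (normc a) ta n g x)); last first.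
    by apply/funext => x /=; rewrite subrKA.
  apply: le_trans (minkowski_EFin _ _ _ hp) _; try exact: measurable_funB.
  by rewrite (_ : e / 2 = e / 4 + e / 4) ?EFinD ?leeD//; lra.
have [v1 pv1 [mv1 fv1]] := real_case _ mr (Lnorm_Re_le hp mf).
have [v2 pv2 [mv2 fv2]] := real_case _ mi (Lnorm_Im_le hp mf).
exists (fun x => (v1 x)%:C + (0 +i* 1) * (v2 x)%:C).
  exact: phase_polynomialD pv1 (phase_polynomialZ (0 +i* 1) pv2).
have -> : (fun x => f x - ((v1 x)%:C + (0 +i* 1) * (v2 x)%:C)) =
    (fun x => (complex.Re (f x) - v1 x) +i* (complex.Im (f x) - v2 x)).
  apply/funext => x; case: (f x) => f1 f2; apply/eqP; rewrite eq_complex /=.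
  by apply/andP; split; apply/eqP; lra.
apply: le_trans (Lp_norm_le_ReIm hp _) _.
  by split => /=; exact: measurable_funB.
by rewrite [e in leRHS]splitr EFinD leeD.
Qed.

(** * The two implications *)

Lemma Lp_normB f g : measurable_complex f -> measurable_complex g ->
  (Lp_norm p (fun x => (f x - g x)%R) <= Lp_norm p f + Lp_norm p g)%E.
Proof.
move=> mf mg; have mNg := measurable_complexM (measurable_complex_cst (-1)) mg.
rewrite -[Lp_norm p g]mul1e -[X in (X%:E * _)%E](normc1 R) -normcN -Lp_normM//.
have -> : (fun x => f x - g x) = (fun x => f x + (-1) * g x).
  by apply/funext => x; rewrite mulN1r.
exact: Lp_normD.
Qed.

(** Once [S n] fixes a polynomial [P] close to [f], the error [f - S n f] is
[(f - P) - S n (f - P)], at most [1 + M] times as large as [f - P]. *)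
Lemma phase_sum_cvg_of_bounded :
  (exists M : R, 0 < M /\ forall f, in_Lp p f -> forall n,
     (Lp_norm p (S n f) <= M%:E * Lp_norm p f)%E) ->
  forall f, in_Lp p f ->
    Lp_norm p (fun x => f x - S n f x) @[n --> \oo] --> 0%E.
Proof.
move=> [M [M0 SM]] f fp.
suff small e : 0 < e -> \forall n \near \oo,
    (Lp_norm p (fun x => (f x - S n f x)%R) <= e%:E)%E.
  apply/fine_cvgP; split.
    near=> n; rewrite ge0_fin_numE ?Lp_norm_ge0//.
    apply: (@le_lt_trans _ _ 1%:E); last by rewrite ltry.
    by near: n; exact: small.
  apply/cvgr0Pnorm_le => e e0; near=> n.
  rewrite /= ger0_norm ?fine_ge0 ?Lp_norm_ge0//.
  have le : (Lp_norm p (fun x => (f x - S n f x)%R) <= e%:E)%E.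
    by near: n; exact: small.
  rewrite -lee_fin fineK// ge0_fin_numE ?Lp_norm_ge0//.
  by apply: le_lt_trans le _; rewrite ltry.
move=> e0; have e10 : 0 < e / (1 + M) by rewrite divr_gt0// addr_gt0.
have [P [pP [N PN]] fP] := phase_polynomial_dense fp e10.
exists N => // n /= Nn.
have dp := in_LpB hp fp pP.
have -> : (fun x => f x - S n f x) =
    (fun x => (f x - P x) - S n (fun x => f x - P x) x).
  apply/funext => x.
  have SB : S n (fun x => f x - P x) x = S n f x - P x.
    have NP := in_LpZ hp (-1) pP.
    rewrite (_ : (fun x => f x - P x) = (fun x => f x + (-1) * P x)).
      by rewrite (phase_sumD ha hta htheta hp)// (phase_sumZ ha hta htheta hp)// mulN1r PN.
    by apply/funext => y; rewrite mulN1r.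
  by rewrite SB opprB addrA subrK.
apply: le_trans (Lp_normB _ _) _; first exact: in_Lp_measurable dp.
  exact: (measurable_phase_sum ha hta htheta).
apply: (@le_trans _ _ ((e / (1 + M))%:E + M%:E * (e / (1 + M))%:E)%E).
  apply: leeD => //; apply: le_trans (SM _ dp n) _.
  by rewrite lee_wpmul2l// lee_fin ltW.
rewrite -EFinM -EFinD lee_fin le_eqVlt; apply/orP; left; apply/eqP.
by field; rewrite gt_eqF// addr_gt0.
Unshelve. all: by end_near. Qed.

Lemma geometric_tail (k m : nat) :
  \sum_(k <= j < m) 6^-1 ^+ j <= 6 / 5 * 6^-1 ^+ k :> R.
Proof.
have pos j : 0 <= 6^-1 ^+ j :> R by rewrite exprn_ge0.
have [mk|km] := leqP m k; first by rewrite big_geq// mulr_ge0.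
have -> : \sum_(k <= j < m) 6^-1 ^+ j = 6 / 5 * (6^-1 ^+ k - 6^-1 ^+ m) :> R.
  elim: m km => // m IH; rewrite ltnS leq_eqVlt => /predU1P[<-|km].
    by rewrite big_nat1 exprS; field.
  by rewrite big_nat_recr ?IH ?(ltnW km)//= exprS; field.
by rewrite ler_wpM2l// gerBl.
Qed.

(** Riesz-Fischer on the circle: real and imaginary parts are summed
separately, and the pointwise limit inherits the period. *)
Lemma in_Lp_complete (u : nat -> R -> R[i]) :
  (forall k : nat, in_Lp p (u k) /\ (Lp_norm p (u k) <= (6^-1 ^+ k)%:E)%E) ->
  exists2 f, in_Lp p f & forall k : nat,
    (Lp_norm p (fun x => (f x - \sum_(j < k) u j x)%R) <= (3 * 6^-1 ^+ k)%:E)%E.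
Proof.
move=> up; have mu_ (k : nat) := in_Lp_measurable (up k).1.
have bB (k m : nat) := geometric_tail k m.
have [g1 [mg1 h1 s1]] := riesz_fischer (P := circle) (b := fun k : nat => 6^-1 ^+ k) hp
  (fun k : nat => (mu_ k).1)
  (fun k : nat => le_trans (Lnorm_Re_le hp (mu_ k)) (up k).2) bB.
have [g2 [mg2 h2 s2]] := riesz_fischer (P := circle) (b := fun k : nat => 6^-1 ^+ k) hp
  (fun k : nat => (mu_ k).2)
  (fun k : nat => le_trans (Lnorm_Im_le hp (mu_ k)) (up k).2) bB.
have mf : measurable_complex (fun x => g1 x +i* g2 x) by [].
have tail (k : nat) : (Lp_norm p (fun x => (g1 x +i* g2 x - \sum_(j < k) u j x)%R) <=
    (3 * 6^-1 ^+ k)%:E)%E.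
  have ReIm_sum x : complex.Re (\sum_(j < k) u j x) = \sum_(j < k) complex.Re (u j x)
      /\ complex.Im (\sum_(j < k) u j x) = \sum_(j < k) complex.Im (u j x).
    elim: (k) => [|m [IH1 IH2]]; first by rewrite !big_ord0.
    by rewrite !big_ord_recr/= ReD ImD IH1 IH2.
  have -> : (fun x => (g1 x +i* g2 x - \sum_(j < k) u j x)%R) =
     (fun x => (g1 x - \sum_(j < k) complex.Re (u j x)) +i*
               (g2 x - \sum_(j < k) complex.Im (u j x))).
    apply/funext => x; have [<- <-] := ReIm_sum x.
    by case: (\sum_(j < k) u j x).
  apply: le_trans (Lp_norm_le_ReIm hp _) _.
    split => /=; apply: measurable_funB => //; apply: measurable_sum => j;
      [exact: (mu_ j).1|exact: (mu_ j).2].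
  apply: le_trans (leeD (h1 k) (h2 k)) _.
  rewrite -EFinD lee_fin; have : 0 <= 6^-1 ^+ k :> R by rewrite exprn_ge0.
  lra.
exists (fun x => g1 x +i* g2 x) => //; have [m1 m2] := mf; split => //.
  move=> x; congr (_ +i* _); [apply: s1|apply: s2] => k;
    by have [[-> _ _ _] _] := up k.
apply: le_lt_trans (ltry (3 * 6^-1 ^+ 0)); have := tail 0%N.
rewrite [X in Lp_norm p X](_ : _ = (fun x => g1 x +i* g2 x)); first by [].
by apply/funext => x; rewrite big_ord0 subr0.
Qed.

End Convergence.

Lemma in_Lp_fin_num (R : realType) (p : R) (f : R -> R[i]) :
  in_Lp p f -> Lp_norm p f \is a fin_num.
Proof. by case=> _ _ _ nf; rewrite ge0_fin_numE ?Lp_norm_ge0. Qed.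

Lemma fine_Lp_normD (R : realType) (p : R) (f g : R -> R[i]) :
  1 <= p -> in_Lp p f -> in_Lp p g ->
  fine (Lp_norm p (fun x => f x + g x)) <=
  fine (Lp_norm p f) + fine (Lp_norm p g).
Proof.
move=> hp fp gp; have ff := in_Lp_fin_num fp; have gf := in_Lp_fin_num gp.
rewrite -(fineD ff gf); apply: fine_le.
- by apply: in_Lp_fin_num; exact: in_LpD.
- by rewrite fin_numD; apply/andP; split; [exact: ff|exact: gf].
- exact: Lp_normD (in_Lp_measurable fp) (in_Lp_measurable gp).
Qed.

Lemma fine_Lp_normB (R : realType) (p : R) (f g : R -> R[i]) :
  1 <= p -> in_Lp p f -> in_Lp p g ->
  fine (Lp_norm p (fun x => f x - g x)) <=
  fine (Lp_norm p f) + fine (Lp_norm p g).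
Proof.
move=> hp fp gp; have ff := in_Lp_fin_num fp; have gf := in_Lp_fin_num gp.
rewrite -(fineD ff gf); apply: fine_le.
- by apply: in_Lp_fin_num; exact: in_LpB.
- by rewrite fin_numD; apply/andP; split; [exact: ff|exact: gf].
- exact: Lp_normB (in_Lp_measurable fp) (in_Lp_measurable gp).
Qed.

Theorem theorem4 (R : realType) (a : R[i]) (ta : R) (theta : R -> R) (p : R)
    (ha : normc a < 1) (hta : a = (normc a)%:C * expi ta)
    (htheta : nonlinear_phase a theta) (hp : 1 <= p) :
  (forall f : R -> R[i], in_Lp p f ->
     Lp_norm p (fun x => f x - phase_sum a ta theta n f x) @[n --> \oo]
       --> 0%E)
  <->
  (exists M : R, 0 < M /\
     forall f : R -> R[i], in_Lp p f -> forall n : nat,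
       (Lp_norm p (phase_sum a ta theta n f) <= M%:E * Lp_norm p f)%E).
Proof.
split; last exact: (phase_sum_cvg_of_bounded ha hta htheta hp).
move=> cvgS.
(* The uniform boundedness principle is applied to the real vector space of
   all functions, to the submodule of [L^p] functions and to the seminorms
   [f |-> ||S_n f||_p]. *)
pose V : lmodType R := (R -> Rcomplex R)%type.
pose Lp (f : V) := in_Lp p (f : R -> R[i]).
pose N (f : V) := fine (Lp_norm p (f : R -> R[i])).
pose q n (f : V) := fine (Lp_norm p (phase_sum a ta theta n (f : R -> R[i]))).
have fin := @in_Lp_fin_num R p.
have Sp n f := @phase_sum_in_Lp R a ta theta p ha hta htheta hp n f.
have scaleE (c : R) (f : V) :
    (c *: f : V) = (fun x => c%:C * (f x : R[i])) :> (R -> R[i]).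
  apply/funext => x; change ((c *: (f x : Rcomplex R)) = c%:C * (f x : R[i]) :> R[i]).
  by case: (f x) => f1 f2; apply/eqP; rewrite eq_complex /= !mul0r subr0 addr0 !eqxx.
have LpZ c f : Lp f -> Lp (c *: f).
  by move=> fp; rewrite /Lp scaleE; exact: in_LpZ.
have LpD f g : Lp f -> Lp g -> Lp (f + g) by exact: in_LpD.
have Lp0 : Lp 0.
  have := LpZ 0 _ (in_Lp_mode ha hta htheta hp 0); by rewrite scale0r.
have N_ge0 f : Lp f -> 0 <= N f by rewrite fine_ge0 ?Lp_norm_ge0.
have NZ c f : Lp f -> N (c *: f) = `|c| * N f.
  move=> fp; rewrite /N scaleE (Lp_normM hp); last exact: in_Lp_measurable fp.
  by rewrite normc_real fineM ?fin.
have qD n f g : Lp f -> Lp g -> q n (f + g) <= q n f + q n g.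
  move=> fp gp; rewrite /q.
  rewrite (_ : phase_sum _ _ _ n (f + g : V) =
    (fun x => phase_sum a ta theta n f x + phase_sum a ta theta n g x)).
    exact: fine_Lp_normD hp (Sp n f fp) (Sp n g gp).
  by apply/funext => x; exact: (phase_sumD ha hta htheta hp n x fp gp).
have qZ n c f : Lp f -> q n (c *: f) = `|c| * q n f.
  move=> fp; have Sf := Sp n f fp; rewrite /q scaleE.
  rewrite (_ : phase_sum _ _ _ _ _ = (fun x => c%:C * phase_sum a ta theta n f x)).
    rewrite (Lp_normM hp); last exact: in_Lp_measurable Sf.
    by rewrite normc_real fineM ?fin.
  by apply/funext => x; exact: (phase_sumZ ha hta htheta hp n c%:C x fp).
have q_cont n : exists C, forall f, Lp f -> q n f <= C * N f.
  eexists => f fp; rewrite -lee_fin /q (fineK (fin _ (Sp n f fp))).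
  exact: Lp_norm_phase_sum_le ha hta htheta hp n f fp.
have complete (u : nat -> V) : (forall k, Lp (u k) /\ N (u k) <= 6^-1 ^+ k) ->
    exists2 f, Lp f & forall k, N (f - \sum_(j < k) u j) <= 3 * 6^-1 ^+ k.
  move=> up; have [k|f fp fu] := @in_Lp_complete R p hp u.
    by have [up1 up2] := up k; split => //; rewrite -(fineK (fin _ up1)) lee_fin.
  exists f => // k; rewrite /N (_ : (f - \sum_(j < k) u j : V) =
      (fun x => (f x : R[i]) - \sum_(j < k) (u j x : R[i]))); last first.
    by apply/funext => x; rewrite /= fct_sumE.
  rewrite -lee_fin fineK ?ge0_fin_numE ?Lp_norm_ge0//.
  by apply: le_lt_trans (fu k) _; rewrite ltry.
(* A convergent sequence is bounded, hence so is [||S_n f||_p] for each [f]. *)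
have ptw f : Lp f -> exists K, forall n, q n f <= K.
  move=> fp; have /fine_cvgP[_ /cvgP /cvg_seq_bounded] := cvgS f fp.
  move=> [B [_ BP]].
  have {}BP n : `|fine (Lp_norm p (fun x => f x - phase_sum a ta theta n f x))|
      <= B + 1 by apply: BP => //; rewrite ltrDl.
  exists (N f + (B + 1)) => n; have Sf := Sp n f fp; have dp := in_LpB hp fp Sf.
  rewrite /q (_ : phase_sum _ _ _ n f =
    (fun x => f x - (f x - phase_sum a ta theta n f x))); last first.
    by apply/funext => x; rewrite subKr.
  apply: le_trans (fine_Lp_normB hp fp dp) _.
  by rewrite lerD2l (le_trans (ler_norm _))//; exact: BP.
have [M [M0 MN]] := uniform_boundedness Lp0 LpD LpZ N_ge0 NZ qD qZ q_cont complete ptw.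
exists M; split => // f fp n.
rewrite -(fineK (fin _ fp)) -(fineK (fin _ (Sp n f fp))) -EFinM lee_fin.
exact: MN.
Qed.
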